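(* The categories $\mathcal{HC}^{\mathrm{op}}$ and $\mathcal{CAU}$ are equivalent, where $\mathcal{HC}$ is the category of compact Hausdorff topological spaces with continuous maps and $\mathcal{CAU}$ is the category of commutative unital $C^*$-algebras with unit-preserving $*$-homomorphisms. In particular, for every commutative $C^*$-algebra $\mathcal{A}$ with unit, there exists a compact Hausdorff space $X$ such that $\mathcal{A}$ is isometrically $*$-isomorphic to $C(X)$.
   Context: All algebras are over $\mathbb{C}$. A $C^*$-algebra is a Banach algebra $(\mathcal{A},\|\cdot\|)$ (a complete normed algebra with $\|ab\|\le\|a\|\|b\|$) with an involution $*$ (satisfying $(a^* )^*=a$, $(\alpha a+\beta b)^*=\overline{\alpha}a^*+\overline{\beta}b^*$, $(ab)^*=b^*a^*$) such that $\|a^*a\|=\|a\|^2$ for all $a$. A $*$-homomorphism is a linear multiplicative map $\phi$ with $\phi(a^* )=\phi(a)^*$; it is a $*$-isomorphism if it is bijective, and it is isometric if $\|\phi(a)\|=\|a\|$ for all $a$. For a compact Hausdorff space $X$, $C(X)$ is the commutative unital $C^*$-algebra of continuous functions $f:X\to\mathbb{C}$ with pointwise operations, norm $\|f\|_\infty=\sup_{x\in X}|f(x)|$ and involution $f^*(x)=\overline{f(x)}$. $\mathcal{C}^{\mathrm{op}}$ denotes the opposite category of $\mathcal{C}$. Two categories $\mathcal{C}$ and $\mathcal{D}$ are equivalent if there are functors $F:\mathcal{C}\to\mathcal{D}$ and $G:\mathcal{D}\to\mathcal{C}$ such that $F\circ G$ is naturally isomorphic to the identity functor of $\mathcal{D}$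 and $G\circ F$ is naturally isomorphic to the identity functor of $\mathcal{C}$. *)

(* Defs.v *)
From HB Require Import structures.
From mathcomp Require Import all_boot all_order all_algebra.
From mathcomp Require Import complex.
From mathcomp Require Import boolp classical_sets functions reals.
From mathcomp Require Import topology normedtype.
From mathcomp Require Import ring.

Set Implicit Arguments.
Unset Strict Implicit.
Unset Printing Implicit Defensive.

Import Order.TTheory GRing.Theory Num.Theory.
Import numFieldNormedType.Exports.

Local Open Scope classical_set_scope.
Local Open Scope ring_scope.

(** Categories. Arrows are compared with Leibniz equality. *)

Record category := Category {
  obj :> Type;
  hom : obj -> obj -> Type;
  idm : forall a, hom a a;
  comp : forall a b c, hom b c -> hom a b -> hom a c;
  comp_idl : forall a b (f : hom a b), comp (idm b) f = f;
  comp_idr : forall a b (f : hom a b), comp f (idm a) = f;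
  compA : forall a b c d (h : hom c d) (g : hom b c) (f : hom a b),
    comp h (comp g f) = comp (comp h g) f }.

Arguments hom {c} a b : rename.
Arguments idm {c} a : rename.
Arguments comp {c a b} {c0} g f : rename.

Definition opposite (C : category) : category :=
  @Category C (fun a b => hom b a) (fun a => idm a)
    (fun a b c g f => comp f g)
    (fun a b f => comp_idr f) (fun a b f => comp_idl f)
    (fun a b c d h g f => esym (compA f g h)).

Record functor (C D : category) := Functor {
  fobj :> C -> D;
  fmap : forall a b : C, hom a b -> hom (fobj a) (fobj b);
  fmap_id : forall a : C, fmap (idm a) = idm (fobj a);
  fmap_comp : forall (a b c : C) (g : hom b c) (f : hom a b),
    fmap (comp g f) = comp (fmap g) (fmap f) }.

Arguments fmap {C D} F {a b} f : rename.

Definition functor_id (C : category) : functor C C :=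
  @Functor C C (fun a => a) (fun a b f => f)
    (fun a => erefl) (fun a b c g f => erefl).

Section functor_comp.
Context (C D E : category) (G : functor D E) (F : functor C D).

Let fmapGF (a b : C) (f : hom a b) := fmap G (fmap F f).

Fact functor_comp_id (a : C) : fmapGF (idm a) = idm (G (F a)).
Proof. by rewrite /fmapGF !fmap_id. Qed.

Fact functor_comp_comp (a b c : C) (g : hom b c) (f : hom a b) :
  fmapGF (comp g f) = comp (fmapGF g) (fmapGF f).
Proof. by rewrite /fmapGF !fmap_comp. Qed.

Definition functor_comp : functor C E :=
  @Functor C E (fun a => G (F a)) fmapGF functor_comp_id functor_comp_comp.
End functor_comp.

Definition naturally_isomorphic (C D : category) (F G : functor C D) : Prop :=
  exists (eta : forall a, hom (F a) (G a)) (eps : forall a, hom (G a) (F a)),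
  [/\ forall a b (f : hom a b), comp (eta b) (fmap F f) = comp (fmap G f) (eta a),
      forall a, comp (eps a) (eta a) = idm (F a) &
      forall a, comp (eta a) (eps a) = idm (G a)].

Definition equivalent_categories (C D : category) : Prop :=
  exists (F : functor C D) (G : functor D C),
    naturally_isomorphic (functor_comp F G) (functor_id D) /\
    naturally_isomorphic (functor_comp G F) (functor_id C).

(** Compact Hausdorff spaces; the empty space is one of them. *)

HB.mixin Record isCompactHausdorff X of Topological X := {
  compact_space : compact [set: X];
  hausdorff : hausdorff_space X }.

#[short(type="compactHausdorffType")]
HB.structure Definition CompactHausdorff :=
  {X of Topological X & isCompactHausdorff X}.

Section HC.

Definition HC_id (X : compactHausdorffType) : continuousType X X := idfun.

Definition HC_comp (X Y Z : compactHausdorffType)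
    (g : continuousType Y Z) (f : continuousType X Y) : continuousType X Z :=
  g \o f.

Fact HC_comp_idl (X Y : compactHausdorffType) (f : continuousType X Y) :
  HC_comp (HC_id Y) f = f.
Proof. exact/continuousEP. Qed.

Fact HC_comp_idr (X Y : compactHausdorffType) (f : continuousType X Y) :
  HC_comp f (HC_id X) = f.
Proof. exact/continuousEP. Qed.

Fact HC_compA (X Y Z T : compactHausdorffType) (h : continuousType Z T)
    (g : continuousType Y Z) (f : continuousType X Y) :
  HC_comp h (HC_comp g f) = HC_comp (HC_comp h g) f.
Proof. exact/continuousEP. Qed.

Definition HC : category :=
  @Category compactHausdorffType (fun X Y => continuousType X Y)
    HC_id HC_comp HC_comp_idl HC_comp_idr HC_compA.

End HC.

(** Unital C*-algebras. The norm of a [normedModType K] takes its (real,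
    nonnegative) values in K itself. The product is part of the mixin because
    Hierarchy Builder cannot join a ring with a normed module over another ring
    ([Num.NumDomain] is already declared as the join of [GRing.PzSemiRing] and
    [Num.SemiNormedZmodule]). There is no axiom [1 != 0]: the zero algebra, which
    is C(empty space), is a unital C*-algebra. *)

Reserved Notation "a *c b" (at level 40, left associativity).

HB.mixin Record isCStarAlgebra (K : numClosedFieldType) A
    of CompleteNormedModule K A := {
  cone : A;
  cmul : A -> A -> A;
  star : A -> A;
  cmulA : forall a b c : A, cmul a (cmul b c) = cmul (cmul a b) c;
  cmul1a : forall a : A, cmul cone a = a;
  cmula1 : forall a : A, cmul a cone = a;
  cmulDl : forall a b c : A, cmul (a + b) c = cmul a c + cmul b c;
  cmulDr : forall a b c : A, cmul a (b + c) = cmul a b + cmul a c;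
  cmulZl : forall (k : K) (a b : A), cmul (k *: a) b = k *: cmul a b;
  cmulZr : forall (k : K) (a b : A), cmul a (k *: b) = k *: cmul a b;
  cnormM : forall a b : A, `|cmul a b| <= `|a| * `|b|;
  starK : forall a : A, star (star a) = a;
  star_semilinear : forall (k l : K) (a b : A),
    star (k *: a + l *: b) = k^* *: star a + l^* *: star b;
  starM : forall a b : A, star (cmul a b) = cmul (star b) (star a);
  cstar_identity : forall a : A, `|cmul (star a) a| = `|a| ^+ 2 }.

#[short(type="cstarAlgType")]
HB.structure Definition CStarAlgebra (K : numClosedFieldType) :=
  {A of CompleteNormedModule K A & isCStarAlgebra K A}.

Notation "a *c b" := (cmul a b) : ring_scope.

HB.mixin Record isComCStarAlgebra (K : numClosedFieldType) A
    of CStarAlgebra K A := {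
  cmulC : forall a b : A, a *c b = b *c a }.

#[short(type="comCStarAlgType")]
HB.structure Definition ComCStarAlgebra (K : numClosedFieldType) :=
  {A of CStarAlgebra K A & isComCStarAlgebra K A}.

Record star_homomorphism (K : numClosedFieldType) (A B : cstarAlgType K)
    (f : A -> B) : Prop := StarHomomorphism {
  starhom_linear : linear f;
  starhomM : {morph f : a b / a *c b};
  starhom_star : {morph f : a / star a} }.

Section CAU.
Context (K : numClosedFieldType).

Record unital_star_hom (A B : cstarAlgType K) := UnitalStarHom {
  ush_fun :> A -> B;
  ush_star_hom : star_homomorphism ush_fun;
  ush1 : ush_fun cone = cone }.

Lemma unital_star_homP (A B : cstarAlgType K) (f g : unital_star_hom A B) :
  f =1 g -> f = g.
Proof.
case: f g => [f f1 f2] [g g1 g2] /= /funext fg; subst g.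
by congr UnitalStarHom; exact: Prop_irrelevance.
Qed.

Fact star_homomorphism_id (A : cstarAlgType K) : star_homomorphism (@idfun A).
Proof. by []. Qed.

Fact star_homomorphism_comp (A B C : cstarAlgType K) (g : B -> C) (f : A -> B) :
  star_homomorphism g -> star_homomorphism f -> star_homomorphism (g \o f).
Proof.
move=> [gl gM gs] [fl fM fs]; split=> [k a b|a b|a] /=.
- by rewrite fl gl.
- by rewrite fM gM.
- by rewrite fs gs.
Qed.

Definition CAU_id (A : comCStarAlgType K) : unital_star_hom A A :=
  UnitalStarHom (star_homomorphism_id A) erefl.

Fact CAU_comp1 (A B C : cstarAlgType K) (g : unital_star_hom B C)
  (f : unital_star_hom A B) : (g \o f) cone = cone.
Proof. by rewrite /= !ush1. Qed.

Definition CAU_comp (A B C : comCStarAlgType K) (g : unital_star_hom B C)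
    (f : unital_star_hom A B) : unital_star_hom A C :=
  UnitalStarHom
    (star_homomorphism_comp (ush_star_hom g) (ush_star_hom f)) (CAU_comp1 g f).

Fact CAU_comp_idl (A B : comCStarAlgType K) (f : unital_star_hom A B) :
  CAU_comp (CAU_id B) f = f.
Proof. exact: unital_star_homP. Qed.

Fact CAU_comp_idr (A B : comCStarAlgType K) (f : unital_star_hom A B) :
  CAU_comp f (CAU_id A) = f.
Proof. exact: unital_star_homP. Qed.

Fact CAU_compA (A B C D : comCStarAlgType K) (h : unital_star_hom C D)
    (g : unital_star_hom B C) (f : unital_star_hom A B) :
  CAU_comp h (CAU_comp g f) = CAU_comp (CAU_comp h g) f.
Proof. exact: unital_star_homP. Qed.

Definition CAU : category :=
  @Category (comCStarAlgType K) (fun A B => unital_star_hom A B)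
    CAU_id CAU_comp CAU_comp_idl CAU_comp_idr CAU_compA.

End CAU.

(** C(X). The complex plane is [R[i]^o], that is [R[i]] with its library
    structure of normed module over itself. *)

Section complex_plane.
Context (R : realType).
Local Notation C := R[i]^o.

Lemma conj_continuous : continuous (Num.conj : C -> C).
Proof.
move=> z; apply/(@cvgrPdist_lt _ C _ (nbhs z)) => e e0; near=> w.
rewrite -rmorphB norm_conjC; near: w.
by have := @nbhsx_ballx _ C z e e0; rewrite -ball_normE.
Unshelve. all: by end_near. Qed.

Lemma normc_ge_Im (z : R[i]) : (`|complex.Im z|%:C)%C <= `|z|.
Proof.
by rewrite normc_def lecR -sqrtr_sqr ler_wsqrtr // lerDr sqr_ge0.
Qed.

Lemma normc_le_ReIm (z : R[i]) :
  `|z| <= ((`|complex.Re z| + `|complex.Im z|)%:C)%C.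
Proof.
rewrite [in leLHS](complexE z) rmorphD (le_trans (ler_normD _ _))// normrM.
by rewrite !normc_def /= !expr0n /= expr1n !(addr0, add0r) sqrtr1 mul1r !sqrtr_sqr.
Qed.

Lemma gtc0_Re (e : R[i]) : 0 < e -> 0 < complex.Re e /\ e = ((complex.Re e)%:C)%C.
Proof.
by move=> e0; split; [move: e0; rewrite ltcE => /andP[]|rewrite RRe_real// gtr0_real].
Qed.

Lemma Re_norm (z : R[i]) : ((complex.Re `|z|)%:C)%C = `|z|.
Proof. by rewrite RRe_real// normr_real. Qed.

Lemma cauchy_nonexpansive (F : set_system C) (u : C -> R) : ProperFilter F ->
  (forall z w : C, `|u z - u w|%:C%C <= `|z - w|) -> cauchy F -> cauchy (u @ F).
Proof.
move=> FF lip /cauchyP Fc; apply/cauchyP => e e0.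
have [|z Fz] := Fc e%:C%C; first by rewrite ltcR.
exists (u z); rewrite /= nbhs_simpl; apply: filterS Fz => w.
rewrite -!ball_normE /= => zw.
by rewrite -ltcR; apply: le_lt_trans zw.
Qed.

Lemma complex_complete (F : set_system C) : ProperFilter F -> cauchy F -> cvg F.
Proof.
move=> FF Fc.
have /cauchy_cvg/cvg_ex[a Fa] : cauchy ((@complex.Re R : C -> R) @ F).
  by apply: cauchy_nonexpansive => // -[? ?] [? ?]; exact: (normc_ge_Re (_ +i* _)%C).
have /cauchy_cvg/cvg_ex[b Fb] : cauchy ((@complex.Im R : C -> R) @ F).
  by apply: cauchy_nonexpansive => // -[? ?] [? ?]; exact: (normc_ge_Im (_ +i* _)%C).
apply/cvg_ex; exists (a +i* b)%C; apply/(@cvgrPdist_lt _ C _ F) => e /gtc0_Re[e0 ->].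
near=> z.
apply: le_lt_trans (normc_le_ReIm _) _; rewrite ltcR.
have az : `|a - complex.Re z| < complex.Re e / 2.
  by near: z; move/cvgrPdist_lt: Fa; apply; rewrite divr_gt0.
have bz : `|b - complex.Im z| < complex.Re e / 2.
  by near: z; move/cvgrPdist_lt: Fb; apply; rewrite divr_gt0.
by move: az bz; case: (z) => c d /= az bz; rewrite [ltRHS]splitr ltrD.
Unshelve. all: by end_near. Qed.

Lemma Re_continuous : continuous (@complex.Re R : C -> R).
Proof.
move=> z; apply/(@cvgrPdist_lt _ R^o _ (nbhs z)) => e e0.
have e0' : 0 < e%:C%C by rewrite ltcR.
near=> w.
rewrite -ltcR; apply: (@le_lt_trans _ _ `|z - w|).
  by case: (z) (w) => ? ? [? ?]; exact: (normc_ge_Re (_ +i* _)%C).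
by near: w; have := @nbhsx_ballx _ C z _ e0'; rewrite -ball_normE.
Unshelve. all: by end_near. Qed.

End complex_plane.

(** A name distinct from [continuousType], so that the sup-norm topology below
    does not compete with the function-space topologies of the library. *)
Definition cfun (R : realType) (X : topologicalType) : Type :=
  continuousType X R[i]^o.

Section cfun_lmodule.
Context (R : realType) (X : topologicalType).
Local Notation C := R[i]^o.
Local Notation CX := (cfun R X).
Implicit Types f g h : CX.

HB.instance Definition _ := Choice.copy CX (continuousType X C).

Definition cfun_fun f : X -> C := f.
Coercion cfun_fun : cfun >-> Funclass.

Lemma cfunP f g : f =1 g -> f = g.
Proof. by move=> fg; exact/continuousEP. Qed.

Lemma cfun_continuous f : continuous (f : X -> C).
Proof. exact: cts_fun. Qed.

Definition mkcfun (f : X -> C) (fc : continuous f) : CX :=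
  (mkcts fc : continuousType X C).

Fact cfun_cst_subproof (k : R[i]) : continuous (cst k : X -> C).
Proof. by move=> x; exact: cvg_cst. Qed.

Fact cfun_opp_subproof f : continuous (fun x => - f x : C).
Proof. by move=> x; exact: (cvgN (@cfun_continuous f x)). Qed.

Fact cfun_add_subproof f g : continuous (fun x => f x + g x : C).
Proof. by move=> x; exact: (cvgD (@cfun_continuous f x) (@cfun_continuous g x)). Qed.

Fact cfun_mul_subproof f g : continuous (fun x => f x * g x : C).
Proof. by move=> x; exact: (cvgM (@cfun_continuous f x) (@cfun_continuous g x)). Qed.

Fact cfun_scale_subproof (k : R[i]) f : continuous (fun x => k * f x : C).
Proof.
by move=> x; exact: (cvgM (@cfun_cst_subproof k x) (@cfun_continuous f x)).
Qed.

Fact cfun_conj_subproof f : continuous (fun x => (f x)^* : C).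
Proof.
move=> x; apply: (@continuous_comp _ _ _ f (Num.conj : C -> C)).
- exact: cfun_continuous.
- exact: conj_continuous.
Qed.

Definition cfun_cst k := mkcfun (@cfun_cst_subproof k).
Definition cfun_opp f := mkcfun (@cfun_opp_subproof f).
Definition cfun_add f g := mkcfun (@cfun_add_subproof f g).
Definition cfun_mul f g := mkcfun (@cfun_mul_subproof f g).
Definition cfun_scale k f := mkcfun (@cfun_scale_subproof k f).
Definition cfun_conj f := mkcfun (@cfun_conj_subproof f).

Fact cfun_addA : associative cfun_add.
Proof. by move=> f g h; apply: cfunP => x; exact: addrA. Qed.
Fact cfun_addC : commutative cfun_add.
Proof. by move=> f g; apply: cfunP => x; exact: addrC. Qed.
Fact cfun_add0 : left_id (cfun_cst 0) cfun_add.
Proof. by move=> f; apply: cfunP => x; exact: add0r. Qed.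
Fact cfun_addN : left_inverse (cfun_cst 0) cfun_opp cfun_add.
Proof. by move=> f; apply: cfunP => x; exact: addNr. Qed.

HB.instance Definition _ :=
  GRing.isZmodule.Build CX cfun_addA cfun_addC cfun_add0 cfun_addN.

Fact cfun_scaleA a b f : cfun_scale a (cfun_scale b f) = cfun_scale (a * b) f.
Proof. by apply: cfunP => x; exact: mulrA. Qed.
Fact cfun_scale1 : left_id 1 cfun_scale.
Proof. by move=> f; apply: cfunP => x; exact: mul1r. Qed.
Fact cfun_scaleDr : right_distributive cfun_scale +%R.
Proof. by move=> k f g; apply: cfunP => x; exact: mulrDr. Qed.
Fact cfun_scaleDl f : {morph cfun_scale^~ f : a b / a + b}.
Proof. by move=> a b; apply: cfunP => x; exact: mulrDl. Qed.

HB.instance Definition _ := GRing.Zmodule_isLmodule.Build R[i] CX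
  cfun_scaleA cfun_scale1 cfun_scaleDr cfun_scaleDl.

End cfun_lmodule.

Section cfun_cstar.
Context (R : realType) (X : compactHausdorffType).
Local Notation C := R[i]^o.
Local Notation CX := (cfun R X).
Implicit Types f g h : CX.

(** On the empty space this is 0, since [sup set0 = 0]. *)
Definition cfun_norm f : R[i] :=
  ((sup [set complex.Re `|f x| | x in [set: X]])%:C)%C.

Lemma cfun_bounded f :
  has_ubound [set complex.Re `|f x| | x in [set: X]].
Proof.
have cn : continuous ((fun x => complex.Re `|f x|) : X -> R).
  move=> x; apply: (@continuous_comp _ C _ (fun x => `|f x| : C)); last first.
    exact: Re_continuous.
  apply: (@continuous_comp _ C C f (fun z => `|z| : C)).
    exact: cfun_continuous.
  exact: (@norm_continuous _ C).
have /compact_bounded[M [_ MP]] :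
    compact ((fun x => complex.Re `|f x|) @` [set: X]).
  apply: continuous_compact; last exact: compact_space.
  exact: continuous_subspaceT.
exists (M + 1) => y /MP; move=> /(_ (M + 1)); rewrite ltrDl => /(_ ltr01).
exact/le_trans/ler_norm.
Qed.

Lemma cfun_norm_ub f x : `|f x| <= cfun_norm f.
Proof.
rewrite -Re_norm lecR; apply: (ub_le_sup (cfun_bounded f)).
by exists x.
Qed.

Lemma cfun_norm_le f (M : R[i]) : 0 <= M -> (forall x, `|f x| <= M) ->
  cfun_norm f <= M.
Proof.
move=> M0 fM; have {M0} [m0 mE] : 0 <= complex.Re M /\ M = ((complex.Re M)%:C)%C.
  by split; [move: M0; rewrite lecE => /andP[]|rewrite RRe_real// ger0_real].
rewrite mE lecR.
have [->|S0] := eqVneq [set complex.Re `|f x| | x in [set: X]] set0.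
  by rewrite sup0.
apply: ge_sup; first exact/set0P.
by move=> _ [x _ <-]; rewrite -lecR Re_norm -mE.
Qed.

Lemma cfun_norm_ge0 f : 0 <= cfun_norm f.
Proof.
rewrite /cfun_norm lecR.
have [->|/set0P[_ [x _ _]]] := eqVneq [set complex.Re `|f x| | x in [set: X]] set0.
  by rewrite sup0.
by rewrite -lecR; exact: (le_trans (normr_ge0 (f x)) (cfun_norm_ub f x)).
Qed.

Fact cfun_normD f g : cfun_norm (f + g) <= cfun_norm f + cfun_norm g.
Proof.
apply: cfun_norm_le => [|x]; first by rewrite addr_ge0// cfun_norm_ge0.
by rewrite (le_trans (ler_normD (f x) (g x)))// lerD// cfun_norm_ub.
Qed.

Fact cfun_norm_scale_le (k : R[i]) f : cfun_norm (k *: f) <= `|k| * cfun_norm f.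
Proof.
apply: cfun_norm_le => [|x]; first by rewrite mulr_ge0// cfun_norm_ge0.
by rewrite [X in `|X|](_ : _ = k * f x)// normrM ler_wpM2l// cfun_norm_ub.
Qed.

Fact cfun_normZ (k : R[i]) f : cfun_norm (k *: f) = `|k| * cfun_norm f.
Proof.
apply/le_anti; rewrite cfun_norm_scale_le /=.
have [->|k0] := eqVneq k 0; first by rewrite normr0 mul0r cfun_norm_ge0.
rewrite -ler_pdivlMl ?normr_gt0// -normfV.
rewrite -[in leLHS](scale1r f) -(mulVf k0) -scalerA.
exact: cfun_norm_scale_le.
Qed.

Fact cfun_norm0_eq0 f : cfun_norm f = 0 -> f = 0.
Proof.
move=> f0; apply: cfunP => x; apply/eqP; rewrite -normr_le0 -f0.
exact: cfun_norm_ub.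
Qed.

HB.instance Definition _ :=
  Lmodule_isNormed.Build R[i] CX cfun_normD cfun_normZ cfun_norm0_eq0.

Fact cfun_complete (F : set_system CX) : ProperFilter F -> cauchy F -> cvg F.
Proof.
move=> FF /cauchyP Fc.
have ev x : cauchy ((fun f : CX => f x) @ F).
  apply/cauchyP => e e0; have [f Ff] := Fc e e0.
  exists (f x); rewrite /= nbhs_simpl; apply: filterS Ff => g.
  rewrite -!ball_normE /=; apply: le_lt_trans.
  exact: (cfun_norm_ub (f - g)).
have {ev} ev x : exists z : C, (fun f : CX => f x) @ F --> z.
  by apply/cvg_ex; exact: complex_complete.
have [l Fl] := choice ev.
have Ful (e : R[i]) : 0 < e -> F [set f | forall x, `|l x - f x| <= e].
  move=> e0; have e20 : 0 < e / 2 by rewrite divr_gt0.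
  have e40 : 0 < e / 2 / 2 by rewrite divr_gt0.
  have [f] := Fc _ e40; rewrite -ball_normE => Ff.
  near=> g; move=> x; near F => h.
  rewrite [e]splitr.
  rewrite (@le_trans _ _ (`|l x - h x| + `|h x - g x|)) ?ler_distD// lerD//.
    by apply/ltW; near: h; move/(@cvgrPdist_lt _ C): (Fl x); apply.
  have fg : `|f - g| < e / 2 / 2 by near: g; exact: Ff.
  have fh : `|f - h| < e / 2 / 2 by near: h; exact: Ff.
  rewrite [e / 2]splitr.
  rewrite (@le_trans _ _ (`|h x - f x| + `|f x - g x|)) ?ler_distD// lerD//.
    by rewrite distrC; apply: le_trans (ltW fh); exact: (cfun_norm_ub (f - h)).
  by apply: le_trans (ltW fg); exact: (cfun_norm_ub (f - g)).
have lc : continuous (l : X -> C).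
  move=> x; apply/(@cvgrPdist_le _ C _ (nbhs x)) => e e0.
  have e30 : 0 < e / 3 by rewrite divr_gt0.
  near F => f; have fl : forall y, `|l y - f y| <= e / 3.
    by near: f; exact: Ful.
  near=> y.
  have fxy : `|f x - f y| <= e / 3.
    near: y; move/(@cvgrPdist_le _ C): (@cfun_continuous R X f x); exact.
  have -> : e = e / 3 + (e / 3 + e / 3) by field.
  rewrite (@le_trans _ _ (`|l x - f x| + `|f x - l y|)) ?ler_distD// lerD//.
  rewrite (@le_trans _ _ (`|f x - f y| + `|f y - l y|)) ?ler_distD// lerD//.
  by rewrite distrC.
apply/cvg_ex; exists (mkcfun lc); apply/cvgrPdist_le => e e0.
have := Ful e e0; apply: filterS => f lf.
by apply: cfun_norm_le; [exact: ltW|exact: lf].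
Unshelve. all: by end_near. Qed.

HB.instance Definition _ := Uniform_isComplete.Build CX cfun_complete.

Fact cfun_mulA : associative (@cfun_mul R X).
Proof. by move=> f g h; apply: cfunP => x; exact: mulrA. Qed.
Fact cfun_mulC : commutative (@cfun_mul R X).
Proof. by move=> f g; apply: cfunP => x; exact: mulrC. Qed.
Fact cfun_mul1f : left_id (cfun_cst X 1) (@cfun_mul R X).
Proof. by move=> f; apply: cfunP => x; exact: mul1r. Qed.
Fact cfun_mulf1 : right_id (cfun_cst X 1) (@cfun_mul R X).
Proof. by move=> f; apply: cfunP => x; exact: mulr1. Qed.
Fact cfun_mulDl : left_distributive (@cfun_mul R X) +%R.
Proof. by move=> f g h; apply: cfunP => x; exact: mulrDl. Qed.
Fact cfun_mulDr : right_distributive (@cfun_mul R X) +%R.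
Proof. by move=> f g h; apply: cfunP => x; exact: mulrDr. Qed.
Fact cfun_mulZl (k : R[i]) f g : cfun_mul (k *: f) g = k *: cfun_mul f g.
Proof. by apply: cfunP => x; exact/esym/mulrA. Qed.
Fact cfun_mulZr (k : R[i]) f g : cfun_mul f (k *: g) = k *: cfun_mul f g.
Proof. by apply: cfunP => x; exact: mulrCA. Qed.
Fact cfun_normM f g : `|cfun_mul f g| <= `|f| * `|g|.
Proof.
apply: cfun_norm_le => [|x]; first by rewrite mulr_ge0.
by rewrite [X in `|X|](_ : _ = f x * g x)// normrM ler_pM// cfun_norm_ub.
Qed.
Fact cfun_conjK f : cfun_conj (cfun_conj f) = f.
Proof. by apply: cfunP => x; exact: conjCK. Qed.
Fact cfun_conj_semilinear (k l : R[i]) f g :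
  cfun_conj (k *: f + l *: g) = k^* *: cfun_conj f + l^* *: cfun_conj g.
Proof.
apply: cfunP => x.
by rewrite -[LHS]/((k * f x + l * g x)^*) rmorphD !rmorphM.
Qed.
Fact cfun_conjM f g :
  cfun_conj (cfun_mul f g) = cfun_mul (cfun_conj g) (cfun_conj f).
Proof.
by apply: cfunP => x; rewrite -[LHS]/((f x * g x)^*) rmorphM; exact: mulrC.
Qed.
Fact cfun_cstar_identity f : `|cfun_mul (cfun_conj f) f| = `|f| ^+ 2.
Proof.
have fE x : `|cfun_mul (cfun_conj f) f x| = `|f x| ^+ 2.
  by rewrite -[LHS]/(`|(f x)^* * f x|) normrM norm_conjC.
apply/le_anti/andP; split.
  apply: cfun_norm_le => [|x]; first by rewrite exprn_ge0.
  by rewrite fE lerXn2r ?nnegrE// cfun_norm_ub.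
rewrite -[leRHS]sqrtCK lerXn2r ?nnegrE ?sqrtC_ge0//.
apply: cfun_norm_le => [|x]; first by rewrite sqrtC_ge0.
rewrite -(@ler_pXn2r _ 2) ?nnegrE ?sqrtC_ge0// sqrtCK -fE.
exact: cfun_norm_ub.
Qed.

HB.instance Definition _ := isCStarAlgebra.Build R[i] CX
  cfun_mulA cfun_mul1f cfun_mulf1 cfun_mulDl cfun_mulDr cfun_mulZl cfun_mulZr
  cfun_normM cfun_conjK cfun_conj_semilinear cfun_conjM cfun_cstar_identity.

HB.instance Definition _ := isComCStarAlgebra.Build R[i] CX cfun_mulC.

End cfun_cstar.

Definition isometrically_star_isomorphic (K : numClosedFieldType)
    (A B : cstarAlgType K) : Prop :=
  exists phi : A -> B,
    [/\ star_homomorphism phi, bijective phi & forall a, `|phi a| = `|a| ].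

(* Main.v *)
Require Import Defs.
From HB Require Import structures.
From mathcomp Require Import all_boot all_order all_algebra.
From mathcomp Require Import complex.
From mathcomp Require Import boolp classical_sets reals.
From mathcomp Require Import topology normedtype sequences.
From mathcomp Require Import ring lra.

Set Implicit Arguments.
Unset Strict Implicit.
Unset Printing Implicit Defensive.

Import Order.TTheory GRing.Theory Num.Theory.
Import numFieldNormedType.Exports.

Local Open Scope classical_set_scope.
Local Open Scope ring_scope.

(** Gelfand duality. A character of a commutative unital C*-algebra A is a
    unital *-homomorphism from A to the complex numbers. The characters, with
    pointwise convergence, form a compact Hausdorff space, the spectrum of A,
    and the Gelfand transform sends a to the function chi |-> chi a. The two
    functors are X |-> C(X) and A |-> spectrum of A, acting on arrows by
    composition; the theorem says that the Gelfand transform A -> C(spectrum A)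
    and the evaluation map X -> spectrum (C(X)) are natural isomorphisms.

    The heart is that characters compute the norm ([character_attains]). The
    argument is real and order-theoretic. If x and y are self-adjoint, the
    C*-identity for z = x + iy gives |x|^2 <= |z|^2 = |x^2 + y^2|. With this
    inequality and completeness the self-adjoint elements behave like real
    functions. A fixed point argument extracts square roots ([segal_root]), so
    that r - x is a square as soon as |x| < r, and in the preordering of sums of
    squares the bounds 0 <= x <= m imply |x| <= |m| ([sos_norm_le]). Hence -1 stays out of
    the preordering generated by the squares and c^2 - |c|^2
    ([segal_character]); by Zorn's lemma it extends to a total preordering
    ([total_preordering]), and an archimedean total preordering is the same
    thing as a real character: x is sent to the cut that it makes in the
    constants ([preord_valueM]). The resulting character phi satisfies
    |phi c| >= |c|, and it complexifies to a character of A. Applied to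
    c = a^* a this shows that the Gelfand transform is isometric.

    Surjectivity of the Gelfand transform is the Stone-Weierstrass theorem
    ([stone_weierstrass]): the image is closed because the transform is
    isometric, and square roots of x^2 + e^2 make it stable under absolute
    values, hence under maxima and minima. That every character of C(X) is an
    evaluation ([ev_surj]) is a compactness argument, and Urysohn's lemma makes
    the evaluation map injective with a continuous inverse. This compactness
    argument and the Stone-Weierstrass theorem both pass from local to global
    by [compact_induction]. *)

(** * Preorderings of a commutative ring *)

Section preorderings.
Context (S : comPzRingType).
Implicit Types (P T : set S) (x y : S).

Record preordering P : Prop := Preordering {
  preordD : forall x y, P x -> P y -> P (x + y);
  preordM : forall x y, P x -> P y -> P (x * y);
  preord_sqr : forall x, P (x * x) }.

Lemma preord0 P : preordering P -> P 0.
Proof. by move=> PP; have := preord_sqr PP 0; rewrite mulr0. Qed.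

Lemma preord1 P : preordering P -> P 1.
Proof. by move=> PP; have := preord_sqr PP 1; rewrite mulr1. Qed.

Definition preord_adjoin P x :=
  [set z | exists p q, [/\ P p, P q & z = p + x * q]].

Lemma preord_adjoinP P x : preordering P -> preordering (preord_adjoin P x).
Proof.
move=> PP; split.
- move=> _ _ [p [q [Pp Pq ->]]] [p' [q' [Pp' Pq' ->]]].
  exists (p + p'), (q + q'); split; [exact: preordD|exact: preordD|ring].
- move=> _ _ [p [q [Pp Pq ->]]] [p' [q' [Pp' Pq' ->]]].
  exists (p * p' + x * x * (q * q')), (p * q' + q * p'); split; last by ring.
    apply: preordD; [by []|exact: preordM|].
    by apply: preordM => //; [exact: preord_sqr|exact: preordM].
  by apply: preordD => //; exact: preordM.
- move=> z; exists (z * z), 0; split; [exact: preord_sqr|exact: preord0|ring].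
Qed.

Lemma sub_preord_adjoin P x : preordering P -> P `<=` preord_adjoin P x.
Proof. by move=> PP p Pp; exists p, 0; split=> //; [exact: preord0|ring]. Qed.

Lemma preord_adjoin_gen P x : preordering P -> preord_adjoin P x x.
Proof.
by move=> PP; exists 0, 1; split; [exact: preord0|exact: preord1|ring].
Qed.

(** In a maximal proper preordering P, if neither x nor - x were in P, then -1
    would be in both P + x P and P - x P, say -1 = p + x q = p' - x q'.
    Multiplying x q = - (1 + p) by x q' = 1 + p' gives
    -1 = p + p' + p p' + x^2 q q', which is in P. *)
Lemma total_preordering T : preordering T -> ~ T (-1) ->
  exists P, [/\ T `<=` P, preordering P, ~ P (-1) & forall x, P x \/ P (- x)].
Proof.
move=> TT T1.
(* Zorn's lemma is applied to sets X such that T `|` X, rather than X, is a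
   proper preordering: then the empty chain has the upper bound set0. *)
pose good (X : set S) := preordering (T `|` X) /\ ~ (T `|` X) (-1).
have [|A [[PP P1] Amax]] := @Zorn_bigcup S good.
  move=> F Fgood Ftot; split; last first.
    by case=> // -[X FX X1]; apply: (Fgood X FX).2; right.
  have key x y : (T `|` \bigcup_(X in F) X) x -> (T `|` \bigcup_(X in F) X) y ->
      T x /\ T y \/ exists2 X, F X & (T `|` X) x /\ (T `|` X) y.
    move=> [Tx|[X FX Xx]] [Ty|[Y FY Yy]]; first by left.
    - by right; exists Y => //; split; [left|right].
    - by right; exists X => //; split; [right|left].
    - right; have [XY|YX] := Ftot _ _ FX FY.
      + by exists Y => //; split; right => //; exact: XY.
      + by exists X => //; split; right => //; exact: YX.
  have up X : F X -> T `|` X `<=` T `|` \bigcup_(X in F) X.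
    by move=> FX x [Tx|Xx]; [left|right; exists X].
  split.
  - move=> x y /key/[apply] -[[Tx Ty]|[X FX [Xx Xy]]].
      by left; exact: preordD.
    by apply: (up X) => //; apply: preordD => //; exact: (Fgood _ FX).1.
  - move=> x y /key/[apply] -[[Tx Ty]|[X FX [Xx Xy]]].
      by left; exact: preordM.
    by apply: (up X) => //; apply: preordM => //; exact: (Fgood _ FX).1.
  - by move=> x; left; exact: preord_sqr.
exists (T `|` A); split=> //.
have adj x : ~ (T `|` A) x -> preord_adjoin (T `|` A) x (-1).
  move=> nx; apply: contrapT => n1.
  apply: (Amax (preord_adjoin (T `|` A) x)).
    split; last first.
      by move=> AA; apply/nx; right; apply: AA; exact: preord_adjoin_gen.
    by move=> z Az; apply: sub_preord_adjoin => //; right.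
  have E : T `|` preord_adjoin (T `|` A) x = preord_adjoin (T `|` A) x.
    by apply: setUidr => z Tz; apply: sub_preord_adjoin => //; left.
  by split; rewrite E//; exact: preord_adjoinP.
move=> x; apply: contrapT => /not_orP[/adj[p [q [Pp Pq E]]] /adj[p' [q' [Pp' Pq' E']]]].
apply: P1.
have -> : -1 = p + p' + p * p' + x * x * (q * q').
  have {}E : x * q = - 1 - p by rewrite E; ring.
  have {}E' : x * q' = 1 + p' by rewrite -[1]opprK E'; ring.
  have -> : x * x * (q * q') = (x * q) * (x * q') by ring.
  by rewrite E E'; ring.
apply: preordD => //.
  by apply: preordD => //; [exact: preordD|exact: preordM].
by apply: preordM => //; [exact: preord_sqr|exact: preordM].
Qed.

End preorderings.

(** * The real character of an archimedean total preordering *)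

Lemma ler_eps (R : realType) (x y : R) :
  (forall e : R, 0 < e -> x <= y + e) -> x <= y.
Proof. by move=> xy; apply/ler_addgt0Pr => e; exact: xy. Qed.

Section archimedean_preordering.
Context (R : realType) (S : comPzRingType) (iota : {rmorphism R -> S}).
Implicit Types (x y z : S) (r s t : R).

Lemma preord_cst (P : set S) r : preordering P -> 0 <= r -> P (iota r).
Proof. by move=> PP r0; rewrite -(sqr_sqrtr r0) expr2 rmorphM; exact: preord_sqr. Qed.

Context (P : set S).
Hypothesis PP : preordering P.
Hypothesis Pproper : ~ P (-1).
Hypothesis Ptotal : forall x, P x \/ P (- x).
Hypothesis Parch : forall x, exists r, P (iota r - x).

(** As P is total, x cuts the constants into those below x and those above x. *)
Definition preord_value x : R := sup [set r | P (x - iota r)].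
Local Notation phi := preord_value.

Lemma preord_sandwich x r s : P (x - iota r) -> P (iota s - x) -> r <= s.
Proof.
move=> Pr Ps; rewrite leNgt; apply/negP => sr; apply: Pproper.
have -> : -1 = (x - iota r + (iota s - x)) * iota (r - s)^-1.
  have -> : x - iota r + (iota s - x) = - iota (r - s) by ring.
  by rewrite mulNr -rmorphM mulfV ?(rmorph1 iota)// subr_eq0 gt_eqF.
apply: preordM => //; first exact: preordD.
by apply: preord_cst => //; rewrite invr_ge0 subr_ge0 ltW.
Qed.

Lemma preord_value_sup x : has_sup [set r | P (x - iota r)].
Proof.
split; last first.
  by have [s Ps] := Parch x; exists s => r Pr; exact: preord_sandwich Pr Ps.
by have [r Pr] := Parch (- x); exists (- r); rewrite /= rmorphN opprK addrC -[x]opprK.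
Qed.

Lemma preord_value_ge x r : P (x - iota r) -> r <= phi x.
Proof. by move=> Pr; apply: ub_le_sup => //; exact: (preord_value_sup x).2. Qed.

Lemma preord_value_le x s : P (iota s - x) -> phi x <= s.
Proof.
move=> Ps; apply: ge_sup; first exact: (preord_value_sup x).1.
by move=> r Pr; exact: preord_sandwich Pr Ps.
Qed.

Lemma preord_value_below x e : 0 < e -> P (x - iota (phi x - e)).
Proof.
move=> e0; have [r Pr rx] := sup_adherent e0 (preord_value_sup x).
have -> : x - iota (phi x - e) = x - iota r + iota (r - (phi x - e)) by ring.
by apply: preordD => //; apply: preord_cst => //; rewrite subr_ge0 ltW.
Qed.

Lemma preord_value_above x e : 0 < e -> P (iota (phi x + e) - x).
Proof.
move=> e0; have [/preord_value_ge|] := Ptotal (x - iota (phi x + e)).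
  by rewrite gerDl leNgt e0.
by rewrite opprB.
Qed.

Lemma preord_value_cst r : phi (iota r) = r.
Proof.
apply/le_anti/andP; split.
  by apply: preord_value_le; rewrite subrr; exact: preord0.
by apply: preord_value_ge; rewrite subrr; exact: preord0.
Qed.

Lemma preord_valueD x y : phi (x + y) = phi x + phi y.
Proof.
apply/le_anti/andP; split; apply: ler_eps => e e0;
  have [d d0 ->] : exists2 d, 0 < d & e = d + d by exists (e / 2); lra.
  apply: preord_value_le.
  have -> : iota (phi x + phi y + (d + d)) - (x + y) =
    iota (phi x + d) - x + (iota (phi y + d) - y) by ring.
  by apply: preordD => //; exact: preord_value_above.
rewrite -lerBlDr; apply: preord_value_ge.
have -> : x + y - iota (phi x + phi y - (d + d)) =
  x - iota (phi x - d) + (y - iota (phi y - d)) by ring.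
by apply: preordD => //; exact: preord_value_below.
Qed.

(** If M bounds w and x lies between - d and d, then
    (d - x) (M + w) + (x + d) (M - w) = 2 (d M - x w) is nonnegative, so the
    value of x w is at most d M, which is arbitrarily small. *)
Lemma preord_value_mul0 x z : phi x = 0 -> phi (x * z) = 0.
Proof.
move=> x0.
suff H w : phi (x * w) <= 0.
  have : phi (x * z) + phi (x * - z) = 0.
    by rewrite -preord_valueD -mulrDr subrr mulr0 -(rmorph0 iota) preord_value_cst.
  have := H z; have := H (- z); lra.
have [r Pr] := Parch w; have [s Ps] := Parch (- w).
pose M : R := `|r| + `|s| + 1; have M0 : 0 < M by rewrite ltr_wpDl ?addr_ge0.
have up t y : t <= M -> P (iota t - y) -> P (iota M - y).
  move=> tM Pt; have -> : iota M - y = iota t - y + iota (M - t) by ring.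
  by apply: preordD => //; apply: preord_cst => //; rewrite subr_ge0.
have {Pr} Pr : P (iota M - w).
  by apply: up Pr; rewrite /M; have := ler_norm r; have := normr_ge0 s; lra.
have {Ps} Ps : P (iota M + w).
  rewrite -[w in X in P X]opprK.
  by apply: up Ps; rewrite /M; have := ler_norm s; have := normr_ge0 r; lra.
apply: ler_eps => e e0; rewrite add0r.
pose d : R := e / M; have d0 : 0 < d by rewrite divr_gt0.
have := preord_value_above x d0; have := preord_value_below x d0.
rewrite x0 !add0r rmorphN opprK => Pb Pa.
apply: preord_value_le.
have -> : iota e - x * w = iota 2^-1 *
   ((iota d - x) * (iota M + w) + (x + iota d) * (iota M - w)).
  have half : iota 2^-1 * 2 = 1.
    rewrite -(rmorph_nat iota 2) -rmorphM mulVf ?pnatr_eq0//; exact: rmorph1.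
  transitivity (iota 2^-1 * 2 * (iota (d * M) - x * w)); last by ring.
  by rewrite half mul1r mulfVK// gt_eqF.
apply: preordM => //; first by apply: preord_cst => //; lra.
by apply: preordD => //; exact: preordM.
Qed.

(** Subtracting its value from each factor reduces to [preord_value_mul0]. *)
Lemma preord_valueM x y : phi (x * y) = phi x * phi y.
Proof.
have c0 z : phi (z - iota (phi z)) = 0.
  by rewrite preord_valueD -rmorphN preord_value_cst subrr.
have -> : x * y = (x - iota (phi x)) * y +
    ((y - iota (phi y)) * iota (phi x) + iota (phi x * phi y)) by ring.
by rewrite !preord_valueD !preord_value_mul0// preord_value_cst !add0r.
Qed.

End archimedean_preordering.

(** * Real algebras whose norm is determined by real characters *)

Section segal_algebra.
Context (R : realType) (S : comPzRingType) (iota : {rmorphism R -> S}).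
Implicit Types (x y z : S) (r s t e : R).

(** The algebra of self-adjoint elements of a nonzero commutative unital
    C*-algebra has such a norm. [segal_sqr] expresses the C*-identity in real
    terms; it makes the norm monotone on squares. *)
Record segal_norm (N : S -> R) : Prop := SegalNorm {
  segal_eq0 : forall x, N x = 0 -> x = 0;
  segalD : forall x y, N (x + y) <= N x + N y;
  segalN : forall x, N (- x) = N x;
  segalM : forall x y, N (x * y) <= N x * N y;
  segal_cst : forall r, N (iota r) = `|r|;
  segal_sqr : forall x y, N x ^+ 2 <= N (x * x + y * y);
  segal_complete : forall u : nat -> S,
    (forall e, 0 < e -> exists m, forall n, (m <= n)%N -> N (u n - u m) <= e) ->
    exists l, forall e, 0 < e -> exists m, forall n, (m <= n)%N -> N (l - u n) <= e }.

Context (N : S -> R).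
Hypothesis NS : segal_norm N.

Lemma segal_ge0 x : 0 <= N x.
Proof.
have := segalD NS x (- x); rewrite segalN// subrr -(rmorph0 iota) (segal_cst NS) normr0.
lra.
Qed.

Lemma segalZ r x : 0 <= r -> N (iota r * x) <= r * N x.
Proof. by move=> r0; rewrite (le_trans (segalM NS _ _))// segal_cst// ger0_norm. Qed.

Lemma small_power r e : 0 <= r -> r < 1 -> 0 < e -> exists m, r ^+ m <= e.
Proof.
move=> r0 r1 e0.
have /cvgrPdist_le/(_ e e0)[m _ /(_ m (leqnn m))] : (fun n => r ^+ n) @ \oo --> (0 : R).
  by apply: cvg_expr; rewrite ger0_norm.
by rewrite sub0r normrN ger0_norm ?exprn_ge0//; exists m.
Qed.

(** With z = 1 - y, the equation z^2 = 1 - x says that y is a fixed point of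
    F y = (x + y^2) / 2. On the ball of radius r = N x < 1, F is a contraction
    of ratio r. *)
Lemma segal_sqrt1B x : N x < 1 -> exists2 y, N y < 1 & 1 - x = (1 - y) * (1 - y).
Proof.
move=> x1; set r := N x in x1; have r0 : 0 <= r := segal_ge0 x.
pose F y := iota 2^-1 * (x + y * y); pose u n := iter n F 0.
have two : iota 2^-1 * 2 = 1.
  by rewrite -(rmorph_nat iota 2) -rmorphM mulVf ?pnatr_eq0//; exact: rmorph1.
have NF y : N y <= r -> N (F y) <= r.
  move=> yr; have h : 0 <= 2^-1 :> R by lra.
  apply: (le_trans (segalZ _ h)).
  have := segalD NS x (y * y); have := segalM NS y y; have := segal_ge0 y.
  rewrite -/r; nra.
have Nu n : N (u n) <= r.
  elim: n => [|n IH]; last exact: NF.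
  by rewrite /u /= -(rmorph0 iota) (segal_cst NS) normr0.
have contr y z : N y <= r -> N z <= r -> N (F y - F z) <= r * N (y - z).
  move=> yr zr; have h : 0 <= 2^-1 :> R by lra.
  have -> : F y - F z = iota 2^-1 * ((y - z) * (y + z)) by rewrite /F; ring.
  apply: (le_trans (segalZ _ h)).
  have := segalD NS y z; have := segalM NS (y - z) (y + z).
  have := segal_ge0 (y - z); nra.
have geo m k : N (u (m + k)%N - u m) <= r ^+ m.
  elim: m => [|m IH].
    rewrite add0n expr0 /u /= subr0; exact: (le_trans (Nu k) (ltW x1)).
  rewrite addSn exprS; apply: (le_trans (contr _ _ (Nu _) (Nu _))).
  by rewrite ler_wpM2l.
have [|l lP] := segal_complete NS (u := u).
  move=> e e0; have [m me] := small_power r0 x1 e0; exists m => n mn.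
  by rewrite -(subnKC mn); exact: le_trans me.
have lr : N l <= r.
  apply: ler_eps => e e0; have [m /(_ m (leqnn m)) lm] := lP _ e0.
  by have := segalD NS (l - u m) (u m); rewrite subrK; have := Nu m; lra.
have Fl : F l = l.
  apply/eqP; rewrite -subr_eq0; apply/eqP/(segal_eq0 NS)/le_anti.
  rewrite segal_ge0 andbT; apply: ler_eps => e e0; rewrite add0r.
  have e20 : 0 < e / 2 by lra.
  have [m lm] := lP _ e20.
  have -> : F l - l = (F l - u m.+1) - (l - u m.+1) by ring.
  apply: (le_trans (segalD NS _ _)); rewrite segalN//.
  have := lm _ (leqnSn m); have := lm _ (leqnn m).
  have := contr l (u m) lr (Nu m); have := segal_ge0 (l - u m).
  by rewrite -[F (u m)]/(u m.+1); nra.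
exists l; first by apply: le_lt_trans x1.
have <- : 2 * F l - l * l = x.
  rewrite /F; transitivity ((iota 2^-1 * 2) * (x + l * l) - l * l); first by ring.
  by rewrite two; ring.
by rewrite Fl; ring.
Qed.

(** The root is given in the form t (1 - y) because characters are nonnegative
    on it, being bounded by the norm. *)
Lemma segal_root x r : N x < r ->
  exists t y, [/\ 0 <= t, N y < 1 &
    iota r - x = (iota t * (1 - y)) * (iota t * (1 - y))].
Proof.
move=> xr; have r0 : 0 < r by apply: le_lt_trans xr; exact: segal_ge0.
have rV : iota r * iota r^-1 = 1.
  by rewrite -rmorphM mulfV ?gt_eqF//; exact: rmorph1.
have [|y y1 E] := @segal_sqrt1B (iota r^-1 * x).
  have h : 0 <= r^-1 by rewrite invr_ge0 ltW.
  by apply: (le_lt_trans (segalZ _ h)); rewrite mulrC ltr_pdivrMr// mul1r.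
exists (Num.sqrt r), y; split=> //; first exact: sqrtr_ge0.
transitivity ((iota (Num.sqrt r) * iota (Num.sqrt r)) * ((1 - y) * (1 - y))); last by ring.
rewrite -E -rmorphM -expr2 sqr_sqrtr ?ltW//.
by rewrite mulrBr mulr1 mulrA rV mul1r.
Qed.

Lemma segal_gap x r : N x < r -> exists z, iota r - x = z * z.
Proof. by move=> /segal_root[t [y [_ _ ->]]]; exists (iota t * (1 - y)). Qed.

Record real_character (phi : S -> R) : Prop := RealCharacter {
  rcharD : {morph phi : x y / x + y};
  rcharM : {morph phi : x y / x * y};
  rchar_cst : forall r, phi (iota r) = r }.

(** For s > N x the element s - x is a square, so its value is nonnegative. *)
Lemma rchar_le phi x : real_character phi -> phi x <= N x.
Proof.
move=> phiP; apply: ler_eps => e e0.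
have [|z E] := @segal_gap x (N x + e); first by rewrite ltrDl.
rewrite -(rchar_cst phiP (N x + e)) -(subrK x (iota _)) E (rcharD phiP) lerDr.
by rewrite (rcharM phiP) -expr2 sqr_ge0.
Qed.

Inductive sum_of_squares : S -> Prop :=
| sos0 : sum_of_squares 0
| sosD x y : sum_of_squares y -> sum_of_squares (x * x + y).

Lemma sum_of_squares_preordering : preordering (sum_of_squares : set S).
Proof.
have D x y : sum_of_squares x -> sum_of_squares y -> sum_of_squares (x + y).
  by elim=> [|z x' _ IH] Sy; rewrite ?add0r// -addrA; apply: sosD; exact: IH.
have M1 z y : sum_of_squares y -> sum_of_squares (z * z * y).
  elim=> [|w y' _ IH]; first by rewrite mulr0; exact: sos0.
  have -> : z * z * (w * w + y') = (z * w) * (z * w) + z * z * y' by ring.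
  exact: sosD.
split=> // [x y Sx Sy|x].
  elim: Sx => [|z x' _ IH]; first by rewrite mul0r; exact: sos0.
  by rewrite mulrDl; apply: D => //; exact: M1.
by rewrite -[x * x]addr0; apply: sosD; exact: sos0.
Qed.

(** The condition N (m - x) <= m for some m is stable under sums, by the
    triangle inequality, and holds for a square z^2: if k - z^2 = w^2, then
    N (w^2) <= N w ^ 2 <= N (w^2 + z^2) = k. *)
Lemma sos_cone x : sum_of_squares x -> exists m, N (iota m - x) <= m.
Proof.
elim=> [|z y _ [m IH]].
  by exists 0; rewrite rmorph0 subr0 -(rmorph0 iota) segal_cst// normr0.
pose k := N (z * z) + 1; have [|w E] := @segal_gap (z * z) k; first by rewrite /k; lra.
exists (k + m).
have -> : iota (k + m) - (z * z + y) = (iota k - z * z) + (iota m - y) by ring.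
apply: (le_trans (segalD NS _ _)); rewrite lerD//.
have := segal_sqr NS w z; rewrite -E subrK segal_cst// ger0_norm; last first.
  by have := segal_ge0 (z * z); rewrite /k; lra.
have := segalM NS w w; rewrite -E expr2 => h1 h2; exact: le_trans h1 h2.
Qed.

(** A sum of squares is, up to an arbitrarily small constant, a single square. *)
Lemma sos_root x e : sum_of_squares x -> 0 < e ->
  exists2 z, x + iota e = z * z & forall phi, real_character phi -> 0 <= phi z.
Proof.
move=> /sos_cone[m xm] e0.
have [|t [y [t0 y1 E]]] := @segal_root (iota m - x) (m + e); first by lra.
exists (iota t * (1 - y)); first by rewrite -E; ring.
move=> phi phiP; rewrite (rcharM phiP) (rchar_cst phiP) mulr_ge0//.
have := rcharD phiP (1 - y) y; rewrite subrK -(rmorph1 iota) (rchar_cst phiP).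
have := rchar_le y phiP; lra.
Qed.

(** Up to e, both x and m - x are squares z^2 and w^2, and
    N (z^2) <= N z ^ 2 <= N (z^2 + w^2), where z^2 + w^2 is the constant m. *)
Lemma sos_norm_le x m : sum_of_squares x -> sum_of_squares (iota m - x) -> N x <= `|m|.
Proof.
move=> Sx Smx; apply: ler_eps => e e0.
have e30 : 0 < e / 3 by lra.
have [z Ez _] := sos_root Sx e30; have [w Ew _] := sos_root Smx e30.
have := segal_sqr NS z w; rewrite -Ez -Ew.
have -> : x + iota (e / 3) + (iota m - x + iota (e / 3)) = iota (m + (e / 3 + e / 3)) by ring.
rewrite segal_cst// => h1; have := segalM NS z z; rewrite -Ez -expr2 => h2.
have := segalD NS (x + iota (e / 3)) (- iota (e / 3)); rewrite addrK segalN// segal_cst//.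
have := ler_normD m (e / 3 + e / 3).
rewrite !(@ger0_norm _ (e / 3 + _)) ?(@ger0_norm _ (e / 3)); lra.
Qed.

(** Let b = c^2 and M = N b. A total preordering that contains b - M gives a
    character whose value at b is at least M. The obstruction would be an
    identity -1 = s + (b - M) t with s and t sums of squares; if k > N t, then
    (M - b) t = 1 + s yields k (M - b) >= (M - b) t >= 1, up to a small error,
    so b <= M - 1 / (2 k), against [sos_norm_le]. *)
Lemma segal_character c : 0 < N c ->
  exists2 phi, real_character phi & N c <= `|phi c|.
Proof.
move=> c0; pose b := c * c; pose M := N c ^+ 2.
have M0 : 0 < M by rewrite exprn_gt0.
have bM : N b = M.
  apply/le_anti; rewrite /M /b; have := segalM NS c c; rewrite -expr2 => -> /=.
  by have := segal_sqr NS c 0; rewrite mulr0 addr0.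
have PS := sum_of_squares_preordering.
pose T := preord_adjoin (sum_of_squares : set S) (b - iota M).
have PT : preordering T := preord_adjoinP _ PS.
have T1 : ~ T (-1).
  move=> [s [t [Ss St E]]].
  (* The summand M^-1 keeps M - e nonnegative, as [sos_norm_le] bounds N b by
     the absolute value of M - e. *)
  pose k := N t + 1 + M^-1; have Mi : 0 < M^-1 by rewrite invr_gt0.
  have t0 := segal_ge0 t.
  have k0 : 0 < k by rewrite /k; lra.
  have [|w Ew] := @segal_gap t k; first by rewrite /k; lra.
  pose e := k^-1 / 2; have ki : 0 < k^-1 by rewrite invr_gt0.
  have e0 : 0 < e by rewrite /e; lra.
  have [|v Ev] := @segal_gap b (M + e); first by rewrite bM; lra.
  have kM : k^-1 <= M by rewrite -[M]invrK lef_pV2 ?posrE// /k; lra.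
  have Sk : sum_of_squares (iota k * (iota (M - e) - b)).
    have -> : iota k * (iota (M - e) - b) =
        (iota (M + e) - b) * (iota k - t) + (s + iota e * t).
      have E1 : (iota M - b) * t = 1 + s by rewrite -[1]opprK E; ring.
      have ke : iota k * iota e + iota k * iota e = 1.
        by rewrite -rmorphM -rmorphD -mulrDr /e -splitr mulfV ?gt_eqF//; exact: rmorph1.
      transitivity
        ((iota (M + e) - b) * iota k - (iota k * iota e + iota k * iota e)).
        by ring.
      rewrite ke.
      transitivity ((iota (M + e) - b) * iota k - (1 + s) + s); first by ring.
      by rewrite -E1; ring.
    apply: (preordD PS); first by rewrite Ew Ev; apply: (preordM PS); exact: preord_sqr.
    by apply: (preordD PS) => //; apply: (preordM PS) => //; apply: preord_cst => //; exact: ltW.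
  have Sb : sum_of_squares (iota (M - e) - b).
    have -> : iota (M - e) - b = iota k^-1 * (iota k * (iota (M - e) - b)).
      rewrite mulrA -rmorphM mulVf ?gt_eqF//.
      transitivity (1 * (iota (M - e) - b)); first by ring.
      by congr (_ * _); apply/esym; exact: rmorph1.
    by apply: (preordM PS) => //; apply: preord_cst => //; exact: ltW.
  have := sos_norm_le (preord_sqr PS c) Sb; rewrite -/b bM ger0_norm; rewrite /e; lra.
have [P [TP PP P1 Ptot]] := total_preordering PT T1.
have Parch x : exists r, P (iota r - x).
  have [|z E] := @segal_gap x (N x + 1); first by lra.
  by exists (N x + 1); rewrite E; exact: preord_sqr.
exists (preord_value iota P).
  by split; [exact: preord_valueD|exact: preord_valueM|exact: preord_value_cst].
rewrite -(@ler_pXn2r _ 2) ?nnegrE ?segal_ge0// -normrX ger0_norm ?sqr_ge0// expr2.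
have Pb : P (b - iota M) by apply: TP; exact: preord_adjoin_gen.
have := preord_value_ge PP P1 Parch Pb; rewrite /M /b preord_valueM//.
Qed.

End segal_algebra.

(** * The ring of a commutative C*-algebra and its self-adjoint part *)

Section complex_norm.
Context (R : realType) (V : normedModType R[i]).
Implicit Types (u v w : V).

(** The norm takes its values among the nonnegative reals of R[i]; its real part
    lives in the totally ordered field R. *)
Definition rnorm v : R := complex.Re `|v|.

Lemma rnormE v : `|v| = ((rnorm v)%:C)%C.
Proof. by rewrite RRe_real// normr_real. Qed.

Lemma rnorm_ge0 v : 0 <= rnorm v.
Proof. by rewrite -lecR -rnormE; exact: normr_ge0. Qed.

Lemma rnorm_le u (x : R) : (`|u| <= x%:C%C) = (rnorm u <= x).
Proof. by rewrite rnormE lecR. Qed.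

Lemma rnormD u v : rnorm (u + v) <= rnorm u + rnorm v.
Proof. by rewrite -lecR rmorphD /= -!rnormE ler_normD. Qed.

Lemma rnormN v : rnorm (- v) = rnorm v.
Proof. by rewrite /rnorm normrN. Qed.

Lemma rnorm_eq0 v : rnorm v = 0 -> v = 0.
Proof. by move=> v0; apply/eqP; rewrite -normr_eq0 rnormE v0. Qed.

End complex_norm.

Lemma rnorm_complete (R : realType) (V : completeNormedModType R[i]) (u : nat -> V) :
  (forall e : R, 0 < e -> exists m, forall n, (m <= n)%N -> rnorm (u n - u m) <= e) ->
  exists l, forall e : R, 0 < e -> exists m, forall n, (m <= n)%N -> rnorm (l - u n) <= e.
Proof.
move=> uC.
have /cauchy_cvg/cvg_ex[l ul] : cauchy (u @ \oo).
  apply/cauchyP => e /gtc0_Re[e0 ->].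
  have e20 : 0 < complex.Re e / 2 by lra.
  have [m um] := uC _ e20; exists (u m); exists m => // n /= mn.
  rewrite -ball_normE /= distrC; apply: (@le_lt_trans _ _ ((complex.Re e / 2)%:C%C)).
    by rewrite rnorm_le um.
  by rewrite ltcR; lra.
exists l => e e0; have e0' : 0 < (e%:C)%C by rewrite ltcR.
move/cvgrPdist_le: ul => /(_ _ e0')[m _ um]; exists m => n mn.
by rewrite -rnorm_le; exact: um.
Qed.

(** A copy of A that carries the ring structure alone. Complex scalars enter it
    through the ring morphism [scalar] below, and the involution is the ring
    endomorphism [adj]. *)
Definition calg (R : realType) (A : comCStarAlgType R[i]) : Type := A.

Section calg.
Context (R : realType) (A : comCStarAlgType R[i]).
Local Notation C := R[i].
Local Notation B := (calg A).

HB.instance Definition _ := GRing.Zmodule.copy B A.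

Fact calg_mulDl : left_distributive (@cmul C A) +%R.
Proof. by move=> a b c; exact: cmulDl. Qed.

HB.instance Definition _ :=
  GRing.Zmodule_isComPzRing.Build B (@cmulA C A) (@cmulC C A) (@cmul1a C A) calg_mulDl.

Definition scalar (k : C) : B := k *: (cone : A).

Fact scalar_zmod_morphism : zmod_morphism scalar.
Proof. by move=> k l; exact: scalerBl. Qed.
Fact scalar_monoid_morphism : monoid_morphism scalar.
Proof.
split=> [|k l]; first exact: scale1r.
rewrite /scalar -[RHS]/(cmul (k *: (cone : A)) (l *: (cone : A))).
by rewrite cmulZl cmulZr cmul1a scalerA.
Qed.
HB.instance Definition _ := GRing.isZmodMorphism.Build C B scalar scalar_zmod_morphism.
HB.instance Definition _ := GRing.isMonoidMorphism.Build C B scalar scalar_monoid_morphism.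

Lemma scalarE (k : C) (a : A) : k *: a = scalar k * (a : B) :> B.
Proof. by rewrite -[RHS]/(cmul (k *: (cone : A)) a) cmulZl cmul1a. Qed.

Definition adj (a : B) : B := star (a : A).

Fact adj_zmod_morphism : zmod_morphism adj.
Proof.
move=> a b; have := star_semilinear 1 (-1) (a : A) (b : A).
by rewrite conjCN1 conjC1 !scale1r !scaleN1r.
Qed.
Lemma star1 : star cone = cone :> A.
Proof. by have := starM (star (cone : A)) cone; rewrite !(starK, cmula1, cmul1a) => <-. Qed.
Fact adj_monoid_morphism : monoid_morphism adj.
Proof.
split=> [|a b]; first exact: star1.
by rewrite mulrC; exact: starM.
Qed.
HB.instance Definition _ := GRing.isZmodMorphism.Build B B adj adj_zmod_morphism.
HB.instance Definition _ := GRing.isMonoidMorphism.Build B B adj adj_monoid_morphism.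

Lemma adjK : involutive adj. Proof. exact: starK. Qed.

Lemma adj_scalar (k : C) : adj (scalar k) = scalar k^*.
Proof.
have := star_semilinear k 0 (cone : A) 0.
by rewrite conjC0 !scale0r !addr0 star1.
Qed.

Lemma rnormM (a b : A) : rnorm (cmul a b) <= rnorm a * rnorm b.
Proof. by rewrite -lecR rmorphM /= -!rnormE cnormM. Qed.

Lemma rnorm_starM (a : A) : rnorm (cmul (star a) a) = rnorm a ^+ 2.
Proof.
by apply: (@complexI R); rewrite rmorphXn /= -!rnormE cstar_identity.
Qed.

(** |b|^2 = |b^* b| <= |b^*| |b| for b = a and for b = a^*. *)
Lemma rnorm_star (a : A) : rnorm (star a) = rnorm a.
Proof.
have le b : rnorm (b : A) <= rnorm (star b).
  have := rnormM (star b) b; rewrite rnorm_starM expr2.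
  have [b0|b0] := eqVneq (rnorm b) 0; first by rewrite b0 rnorm_ge0.
  by rewrite ler_pM2r// lt_neqAle eq_sym b0 rnorm_ge0.
by apply/le_anti; rewrite le andbT -{2}[a]starK le.
Qed.

Lemma rnormZ (k : C) (a : A) : rnorm (k *: a) = complex.Re `|k| * rnorm a.
Proof.
apply: (@complexI R); rewrite rmorphM /= -!rnormE normrZ.
by congr (_ * _); rewrite RRe_real// normr_real.
Qed.

Lemma rnorm1 : (cone : A) <> 0 -> rnorm (cone : A) = 1.
Proof.
move=> n0; have := rnorm_starM cone; rewrite star1 cmul1a => /eqP.
rewrite -subr_eq0 expr2 -{1}[rnorm _]mulr1 -mulrBr mulf_eq0 => /orP[/eqP/rnorm_eq0//|].
by rewrite subr_eq0 => /eqP.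
Qed.

Definition self_adjoint : {pred B} := [pred a | adj a == a].

Fact self_adjoint_subring : subring_closed self_adjoint.
Proof.
split=> [|a b|a b]; rewrite !inE; first by rewrite rmorph1.
  by move=> /eqP E /eqP F; rewrite rmorphB /= E F.
by move=> /eqP E /eqP F; rewrite rmorphM /= E F.
Qed.

Record selfadj := SelfAdj { sa_val :> B; sa_valP : sa_val \in self_adjoint }.
HB.instance Definition _ := [isSub for sa_val].
HB.instance Definition _ := [Choice of selfadj by <:].
HB.instance Definition _ :=
  GRing.SubChoice_isSubComPzRing.Build B self_adjoint selfadj self_adjoint_subring.

Lemma sa_adj (x : selfadj) : adj x = x.
Proof. exact/eqP/(sa_valP x). Qed.

Fact sa_cst_subproof (r : R) : scalar (r%:C)%C \in self_adjoint.
Proof. by rewrite inE adj_scalar; apply/eqP; congr scalar; exact: conjc_real. Qed.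
Definition sa_cst (r : R) : selfadj := SelfAdj (sa_cst_subproof r).
Fact sa_cst_zmod_morphism : zmod_morphism sa_cst.
Proof. by move=> r s; apply: val_inj; rewrite /= !rmorphB. Qed.
Fact sa_cst_monoid_morphism : monoid_morphism sa_cst.
Proof. by split=> [|r s]; apply: val_inj; rewrite /= ?rmorph1// !rmorphM. Qed.
HB.instance Definition _ := GRing.isZmodMorphism.Build R selfadj sa_cst sa_cst_zmod_morphism.
HB.instance Definition _ := GRing.isMonoidMorphism.Build R selfadj sa_cst sa_cst_monoid_morphism.

Definition sa_norm (x : selfadj) : R := rnorm (val x : A).

End calg.

(** * Characters attain the norm *)

Section gelfand_isometry.
Context (R : realType) (A : comCStarAlgType R[i]).
Local Notation C := R[i].
Local Notation B := (calg A).
Local Notation S := (selfadj A).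
Implicit Types (a b : A) (x y : S).

(** [segal_sqr] is the C*-identity for z = x + iy, where z^* z = x^2 + y^2 and
    2 x = z + z^*. *)
Lemma sa_norm_segal : (cone : A) <> 0 -> segal_norm (@sa_cst R A) (@sa_norm R A).
Proof.
move=> n0; split.
- by move=> x /rnorm_eq0 x0; exact: val_inj.
- by move=> x y; exact: rnormD.
- by move=> x; exact: rnormN.
- by move=> x y; exact: (@rnormM R A (val x) (val y)).
- move=> r; rewrite /sa_norm -[val _]/(((r%:C)%C : C) *: (cone : A)) rnormZ rnorm1// mulr1.
  by apply: (@complexI R); rewrite RRe_real ?normr_real// normc_def /= expr0n addr0 sqrtr_sqr.
- move=> x y; pose z : A := val x + 'i *: val y.
  have zE : star z = val x - 'i *: val y.
    rewrite /z -[val x]scale1r star_semilinear conjC1 !scale1r conjCi scaleNr.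
    by congr (_ - _ *: _); [exact: sa_adj|exact: sa_adj].
  have zz : cmul (star z) z = val (x * x + y * y).
    rewrite zE /z !scalarE.
    pose p : B := val x; pose q : B := val y; pose s : B := scalar A 'i.
    change ((p - s * q) * (p + s * q) = p * p + q * q).
    have s2 : s ^+ 2 = -1 by rewrite -rmorphXn sqrCi rmorphN; congr (- _); exact: rmorph1.
    transitivity (p * p - s ^+ 2 * (q * q)); first by ring.
    by rewrite s2; ring.
  rewrite /sa_norm -zz rnorm_starM lerXn2r ?nnegrE ?rnorm_ge0//.
  have z2 : z + star z = (2 : C) *: (val x : A).
    by rewrite zE /z addrACA subrr addr0 scaler_nat mulr2n.
  have := rnormD z (star z); rewrite rnorm_star z2 rnormZ normr_nat.
  by rewrite -[complex.Re 2]/(1 + 1 : R); lra.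
- move=> u uC; have [|l ul] := @rnorm_complete R A (fun n => val (u n) : A).
    exact: uC.
  have lsa : (l : B) \in @self_adjoint R A.
    rewrite inE -subr_eq0; apply/eqP/rnorm_eq0/le_anti; rewrite rnorm_ge0 andbT.
    apply: ler_eps => e e0; rewrite add0r.
    have e20 : 0 < e / 2 by lra.
    have [m /(_ m (leqnn m)) lm] := ul _ e20.
    have -> : adj (l : B) - l = adj ((l : B) - val (u m)) - ((l : B) - val (u m)).
      by rewrite rmorphB /= sa_adj; ring.
    apply: (le_trans (rnormD _ _)); rewrite rnormN rnorm_star; lra.
  by exists (SelfAdj lsa); exact: ul.
Qed.

Record character := Character {
  ch_fun :> A -> C;
  chD : forall a b, ch_fun (a + b) = ch_fun a + ch_fun b;
  chM : forall a b, ch_fun (cmul a b) = ch_fun a * ch_fun b;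
  chZ : forall k a, ch_fun (k *: a) = k * ch_fun a;
  ch_star : forall a, ch_fun (star a) = (ch_fun a)^*;
  ch1 : ch_fun cone = 1 }.

Lemma characterP (chi xi : character) : chi =1 xi -> chi = xi.
Proof.
case: chi xi => [f fD fM fZ fS f1] [g gD gM gZ gS g1] /= /funext fg; subst g.
by congr Character; exact: Prop_irrelevance.
Qed.

Lemma ch0 (chi : character) : chi 0 = 0.
Proof. by rewrite -(scale0r 0) chZ mul0r. Qed.

Lemma chN (chi : character) a : chi (- a) = - chi a.
Proof. by rewrite -scaleN1r chZ mulN1r. Qed.

Lemma character_nontrivial (chi : character) : (cone : A) <> 0.
Proof. by move=> e; have := ch1 chi; rewrite e ch0 => /eqP; rewrite eq_sym oner_eq0. Qed.

Lemma conj_half : (2^-1 : C)^* = 2^-1.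
Proof. by apply/CrealP; rewrite rpredV realn. Qed.

Fact sa_re_subproof (a : B) : scalar A 2^-1 * (a + adj a) \in @self_adjoint R A.
Proof.
rewrite inE rmorphM rmorphD /= adjK adj_scalar conj_half.
by apply/eqP; ring.
Qed.
Definition sa_re (a : B) : S := SelfAdj (sa_re_subproof a).

Lemma conj_i_half : (- 'i / 2 : C)^* = 'i / 2.
Proof.
transitivity ((- 'i : C)^* * (2^-1)^*); first exact: rmorphM.
by rewrite conj_half raddfN /= conjCi opprK.
Qed.

Fact sa_im_subproof (a : B) : scalar A (- 'i / 2) * (a - adj a) \in @self_adjoint R A.
Proof.
rewrite inE rmorphM rmorphB /= adjK adj_scalar conj_i_half mulNr rmorphN.
by apply/eqP; rewrite /=; ring.
Qed.
Definition sa_im (a : B) : S := SelfAdj (sa_im_subproof a).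

Lemma sa_reD (a b : B) : sa_re (a + b) = sa_re a + sa_re b.
Proof. by apply: val_inj; rewrite /= rmorphD; ring. Qed.

Lemma sa_imD (a b : B) : sa_im (a + b) = sa_im a + sa_im b.
Proof. by apply: val_inj; rewrite /= rmorphD /=; ring. Qed.

Lemma scalar_half2 : scalar A 2^-1 * 2 = 1.
Proof.
rewrite -(rmorph_nat (@scalar R A) 2) -rmorphM mulVf ?pnatr_eq0//.
exact: rmorph1.
Qed.

Lemma scalarI : scalar A (- 'i / 2) = - (scalar A 'i * scalar A 2^-1).
Proof. by rewrite mulNr rmorphN rmorphM. Qed.

Lemma scalari2 : scalar A 'i * scalar A 'i = -1.
Proof. by rewrite -rmorphM -expr2 sqrCi rmorphN; congr (- _); exact: rmorph1. Qed.

Lemma sa_reM (a b : B) : sa_re (a * b) = sa_re a * sa_re b - sa_im a * sa_im b.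
Proof.
apply: val_inj; rewrite /= scalarI (rmorphM (@adj R A)).
set h := scalar A 2^-1; set j := scalar A 'i.
transitivity (h * (h * 2) * (a * b + adj a * adj b)).
  by rewrite scalar_half2; ring.
transitivity (h * h * ((a + adj a) * (b + adj b)) -
  h * h * (j * j) * ((a - adj a) * (b - adj b))).
  by rewrite scalari2; ring.
by ring.
Qed.

Lemma sa_imM (a b : B) : sa_im (a * b) = sa_re a * sa_im b + sa_im a * sa_re b.
Proof.
apply: val_inj; rewrite /= scalarI (rmorphM (@adj R A)).
set h := scalar A 2^-1; set j := scalar A 'i.
transitivity (- j * h * (h * 2) * (a * b - adj a * adj b)).
  by rewrite scalar_half2; ring.
by ring.
Qed.

Lemma sa_re_adj (a : B) : sa_re (adj a) = sa_re a.
Proof. by apply: val_inj; rewrite /= adjK addrC. Qed.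

Lemma sa_im_adj (a : B) : sa_im (adj a) = - sa_im a.
Proof. by apply: val_inj; rewrite /= adjK; ring. Qed.

Lemma sa_re_val x : sa_re (val x) = x.
Proof.
apply: val_inj; rewrite /= sa_adj.
by transitivity (scalar A 2^-1 * 2 * (sa_val x : B)); [ring|rewrite scalar_half2 mul1r].
Qed.

Lemma sa_im_val x : sa_im (val x) = 0.
Proof. by apply: val_inj; rewrite /= sa_adj subrr mulr0. Qed.

Lemma sa_re_im (a : B) : a = val (sa_re a) + scalar A 'i * val (sa_im a).
Proof.
rewrite /= scalarI; set h := scalar A 2^-1; set j := scalar A 'i.
transitivity (h * (a + adj a) - j * j * h * (a - adj a)); last by ring.
rewrite scalari2; transitivity (h * 2 * a); last by ring.
by rewrite scalar_half2 mul1r.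
Qed.

Lemma scalar_ReIm (k : C) : scalar A k =
  val (sa_cst A (complex.Re k)) + scalar A 'i * val (sa_cst A (complex.Im k)).
Proof. by rewrite {1}(complexE k) rmorphD rmorphM. Qed.

Lemma scalar_conj (k : C) : scalar A k^* =
  val (sa_cst A (complex.Re k)) - scalar A 'i * val (sa_cst A (complex.Im k)).
Proof.
rewrite scalar_ReIm -mulrN.
have -> : complex.Re k^* = complex.Re k by case: k.
have -> : complex.Im k^* = - complex.Im k by case: k.
by rewrite (rmorphN (sa_cst A)).
Qed.

Lemma sa_re_scalar (k : C) : sa_re (scalar A k) = sa_cst A (complex.Re k).
Proof.
apply: val_inj; rewrite /= adj_scalar scalar_conj (scalar_ReIm k) /=.
set r := scalar A ((complex.Re k)%:C)%C; set s := scalar A 2^-1.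
set t := scalar A ((complex.Im k)%:C)%C.
transitivity (s * 2 * r); first by ring.
by rewrite /s scalar_half2 mul1r.
Qed.

Lemma sa_im_scalar (k : C) : sa_im (scalar A k) = sa_cst A (complex.Im k).
Proof.
apply: val_inj; rewrite /= adj_scalar scalar_conj (scalar_ReIm k) scalarI.
set j := scalar A 'i; set r := scalar A ((complex.Re k)%:C)%C.
set h := scalar A 2^-1; set t := scalar A ((complex.Im k)%:C)%C.
transitivity (- (j * j) * (h * 2) * t); first by ring.
by rewrite scalari2 scalar_half2; ring.
Qed.

Section complexify.
Context (phi : S -> R) (phiP : real_character (@sa_cst R A) phi).

Lemma rcharN x : phi (- x) = - phi x.
Proof.
apply/eqP; rewrite -addr_eq0 -(rcharD phiP) addNr -(rmorph0 (sa_cst A)).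
by rewrite (rchar_cst phiP).
Qed.

(** A real character of the self-adjoint part extends along a = re a + i im a. *)
Definition complexify (a : A) : C := (phi (sa_re a) +i* phi (sa_im a))%C.

Fact complexifyM a b : complexify (cmul a b) = complexify a * complexify b.
Proof.
rewrite /complexify -[cmul a b]/((a : B) * (b : B)) sa_reM sa_imM.
by rewrite !(rcharD phiP) rcharN !(rcharM phiP).
Qed.

Fact complexifyD a b : complexify (a + b) = complexify a + complexify b.
Proof. by rewrite /complexify sa_reD sa_imD !(rcharD phiP). Qed.

Fact complexify_scalar k : complexify (scalar A k) = k.
Proof.
by rewrite /complexify sa_re_scalar sa_im_scalar !(rchar_cst phiP); case: k.
Qed.

Fact complexifyZ k a : complexify (k *: a) = k * complexify a.
Proof.
by rewrite scalarE -[_ * _]/(cmul (scalar A k : A) a) complexifyM complexify_scalar.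
Qed.

Fact complexify_star a : complexify (star a) = (complexify a)^*.
Proof. by rewrite /complexify -[star a]/(adj (a : B)) sa_re_adj sa_im_adj rcharN. Qed.

Fact complexify1 : complexify cone = 1.
Proof. by rewrite -[RHS]complexify_scalar /scalar scale1r. Qed.

Definition complexified : character :=
  Character complexifyD complexifyM complexifyZ complexify_star complexify1.

End complexify.

Lemma ch_sa_real (chi : character) x : chi (val x) = ((complex.Re (chi (val x)))%:C)%C.
Proof.
rewrite RRe_real//; apply/CrealP; rewrite -ch_star.
by congr (chi _); exact: sa_adj.
Qed.

Lemma ch_scalar (chi : character) k : chi (scalar A k) = k.
Proof. by rewrite chZ ch1 mulr1. Qed.

Lemma ch_real_character (chi : character) :
  real_character (@sa_cst R A) (fun x : S => complex.Re (chi (val x))).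
Proof.
split.
- by move=> x y /=; rewrite -raddfD /= -chD.
- move=> x y /=; apply: (@complexI R); rewrite rmorphM /= -!ch_sa_real -chM.
  exact/esym/(ch_sa_real chi (x * y)).
- by move=> r; rewrite /= ch_scalar.
Qed.

Fact sa_sq_subproof (a : B) : adj a * a \in @self_adjoint R A.
Proof. by rewrite inE rmorphM /= adjK mulrC. Qed.
Definition sa_sq (a : B) : S := SelfAdj (sa_sq_subproof a).

Lemma sa_norm_sq (a : A) : sa_norm (sa_sq a) = rnorm a ^+ 2.
Proof. exact: rnorm_starM. Qed.

Lemma ch_sq (chi : character) (a : A) :
  chi (val (sa_sq a)) = `|chi a| ^+ 2.
Proof. by rewrite normCK mulrC -ch_star -chM. Qed.

(** By the C*-identity it suffices to bound chi on the self-adjoint element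
    a^* a, where chi is a real character. *)
Lemma ch_le (chi : character) a : `|chi a| <= `|a|.
Proof.
rewrite -(@ler_pXn2r _ 2) ?nnegrE// -ch_sq ch_sa_real rnormE -rmorphXn /= lecR.
rewrite -sa_norm_sq.
exact: (rchar_le (sa_norm_segal (character_nontrivial chi)) (sa_sq a)
  (ch_real_character chi)).
Qed.

(** A real character that attains the norm of a^* a takes there the value
    |chi a|^2, while the norm of a^* a is |a|^2. *)
Lemma character_attains a : a <> 0 -> exists chi : character, `|chi a| = `|a|.
Proof.
move=> a0; have n0 : (cone : A) <> 0.
  move=> e; apply: a0; rewrite -(cmul1a a) e.
  by rewrite -[X in cmul X _](scale0r (cone : A)) cmulZl; exact: scale0r.
have a0' : 0 < rnorm a.
  by rewrite lt_neqAle rnorm_ge0 andbT; apply/eqP => /esym/rnorm_eq0/a0.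
have [|phi phiP le] := segal_character (sa_norm_segal n0) (c := sa_sq a).
  by rewrite sa_norm_sq exprn_gt0.
have [chi E] : exists chi : character, chi (val (sa_sq a)) = ((phi (sa_sq a))%:C)%C.
  exists (complexified phiP); rewrite -[LHS]/(complexify phi _) /complexify.
  by rewrite sa_re_val sa_im_val -(rmorph0 (sa_cst A)) (rchar_cst phiP).
exists chi; apply/le_anti; rewrite ch_le /=.
have := ch_sq chi a; rewrite E => E2.
rewrite -(@ler_pXn2r _ 2) ?nnegrE// -E2 rnormE -rmorphXn lecR /= -sa_norm_sq.
rewrite (le_trans le)// ger0_norm// -lecR E2.
by rewrite exprn_ge0.
Qed.

End gelfand_isometry.

(** * The spectrum is a compact Hausdorff space *)

Section spectrum.
Context (R : realType) (A : comCStarAlgType R[i]).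
Local Notation C := R[i]^o.
Local Notation spec := (character A).

HB.instance Definition _ := gen_eqMixin spec.
HB.instance Definition _ := gen_choiceMixin spec.

Definition ch_ptws (chi : spec) : {ptws A -> C} := chi.

HB.instance Definition _ := Topological.copy spec (initial_topology ch_ptws).

Lemma spectrum_cvg (F : set_system spec) (chi : spec) : Filter F ->
  (forall a, (fun xi : spec => xi a : C) @ F --> (chi a : C)) -> F --> chi.
Proof.
move=> FF Fchi U; rewrite nbhsE => -[_ [[V oV <-] Vchi] VU].
have /(_ V) : ch_ptws @ F --> ch_ptws chi.
  by apply/pointwise_cvgP => a; exact: Fchi.
by move=> /(_ (open_nbhs_nbhs (conj oV Vchi))) FV; exact: (filterS VU FV).
Qed.

Lemma ch_eval_continuous a : continuous (fun xi : spec => xi a : C).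
Proof.
move=> chi; have H : ch_ptws @ chi --> ch_ptws chi by exact: initial_continuous.
have K := ((@pointwise_cvgP A C (ch_ptws @ chi) (ch_ptws chi) _).1 H a).
exact: (K (@fmap_filter _ _ ch_ptws _ (nbhs_filter chi))).
Qed.

End spectrum.

Section ultrafilter_limits.
Context (R : realType) (T : Type) (F : set_system T) (FU : UltraFilter F).

(** A cluster point of the image of an ultrafilter is a limit: the preimage of a
    neighbourhood of it, or its complement, belongs to the ultrafilter. *)
Lemma ultra_cvg_real (u : T -> R) (M : R) : (forall t, `|u t| <= M) ->
  exists p : R, u @ F --> p.
Proof.
move=> uM; have [|p [_ pF]] := @segment_compact R (- M) M (u @ F) _.
  by apply: nearW => t /=; rewrite in_itv /= -ler_norml.
exists p => V Vp; have [//|FV] := in_ultra_setVsetC (u @^-1` V) FU.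
have FV' : (u @ F) (~` V) by exact: FV.
by have [x []] := pF _ _ FV' Vp.
Qed.

Lemma ultra_cvg_complex (u : T -> R[i]^o) (M : R) :
  (forall t, complex.Re `|u t| <= M) -> exists z : R[i]^o, u @ F --> z.
Proof.
move=> uM.
have [t|p up] := @ultra_cvg_real (fun t => complex.Re (u t)) M.
  apply: le_trans (uM t); rewrite -lecR Re_norm.
  by case: (u t) => ? ?; exact: (normc_ge_Re (_ +i* _)%C).
have [t|q uq] := @ultra_cvg_real (fun t => complex.Im (u t)) M.
  apply: le_trans (uM t); rewrite -lecR Re_norm; exact: normc_ge_Im.
exists (p +i* q)%C; apply/(@cvgrPdist_lt _ R[i]^o _ (u @ F)) => e /gtc0_Re[e0 ->].
have e20 : 0 < complex.Re e / 2 by rewrite divr_gt0.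
have Fp : F [set t | `|p - complex.Re (u t)| < complex.Re e / 2].
  by move/cvgrPdist_lt: up; exact.
have Fq : F [set t | `|q - complex.Im (u t)| < complex.Re e / 2].
  by move/cvgrPdist_lt: uq; exact.
change (F [set t | `|(p +i* q)%C - u t| < (complex.Re e)%:C%C]).
apply: filterS (filterI Fp Fq) => t /= [].
move=> pt qt; apply: le_lt_trans (normc_le_ReIm _) _; rewrite ltcR.
by move: pt qt; case: (u t) => c d /= pt qt; rewrite [ltRHS]splitr ltrD.
Qed.

End ultrafilter_limits.

Section spectrum_compact.
Context (R : realType) (A : comCStarAlgType R[i]).
Local Notation C := R[i]^o.
Local Notation spec := (character A).

(** Along an ultrafilter each evaluation converges, being bounded by [ch_le];
    the identities that define characters pass to the pointwise limit. *)
Fact spectrum_compact : compact [set: spec].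
Proof.
rewrite compact_ultra => F FU _.
have lim a : exists z : C, (fun chi : spec => chi a : C) @ F --> z.
  apply: (@ultra_cvg_complex R _ F FU _ (rnorm a)) => chi.
  by rewrite -lecR Re_norm -rnormE; exact: ch_le.
have [l Fl] := choice lim.
have uniq (u : spec -> C) (z w : C) : u @ F --> z -> u @ F --> w -> z = w.
  by apply: cvg_unique; exact: (@norm_hausdorff _ C).
have lD a b : l (a + b) = l a + l b.
  apply: (uniq _ _ _ (Fl (a + b))).
  under eq_fun do rewrite chD.
  exact: (cvgD (Fl a) (Fl b)).
have lM a b : l (cmul a b) = l a * l b.
  apply: (uniq _ _ _ (Fl (cmul a b))).
  under eq_fun do rewrite chM.
  exact: (cvgM (Fl a) (Fl b)).
have lZ k a : l (k *: a) = k * l a.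
  apply: (uniq _ _ _ (Fl (k *: a))).
  under eq_fun do rewrite chZ.
  exact: (cvgM (cvg_cst _) (Fl a)).
have lS a : l (star a) = (l a)^*.
  apply: (uniq _ _ _ (Fl (star a))).
  under eq_fun do rewrite ch_star.
  have K := (@cvg_comp _ C C (fun chi : spec => chi a : C) (Num.conj : C -> C)
    F _ _ (Fl a) (@conj_continuous R (l a))).
  exact: K.
have l1 : l cone = 1.
  apply: (uniq _ _ _ (Fl cone)).
  under eq_fun do rewrite ch1.
  exact: cvg_cst.
exists (Character lD lM lZ lS l1); split=> //.
by apply: spectrum_cvg => a; exact: Fl.
Qed.

Fact spectrum_hausdorff : hausdorff_space spec.
Proof.
move=> chi xi cl; apply: characterP => a.
apply: (@norm_hausdorff _ C) => U V Uchi Vxi.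
have [zeta [Uz Vz]] := cl _ _ (ch_eval_continuous Uchi) (ch_eval_continuous Vxi).
by exists (zeta a).
Qed.

HB.instance Definition _ := isCompactHausdorff.Build spec spectrum_compact spectrum_hausdorff.

End spectrum_compact.

(** * The Gelfand transform is onto: Stone-Weierstrass *)

(** If P failed on the whole space, the complements of the sets satisfying P
    would form a proper filter; no point with a neighbourhood satisfying P can
    be a cluster point of it. *)
Lemma compact_induction (X : topologicalType) (P : set X -> Prop) :
  compact [set: X] -> P set0 ->
  (forall U V, P U -> P V -> P (U `|` V)) ->
  (forall U V, U `<=` V -> P V -> P U) ->
  (forall x : X, exists2 U, nbhs x U & P U) -> P [set: X].
Proof.
move=> cX P0 PU Psub Ploc; apply: contrapT => nPT.
pose F : set_system X := [set U | P (~` U)].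
have FF : ProperFilter F.
  split; first by rewrite /F /= setC0.
  split; first by rewrite /F /= setCT.
    by move=> U V FU FV; rewrite /F /= setCI; exact: PU.
  by move=> U V UV; apply: Psub => x nVx /UV.
have [x [_ xF]] := cX F FF filterT.
have [U xU PUx] := Ploc x.
have FU : F (~` U) by rewrite /F /= setCK.
by have [y []] := xF _ _ FU xU.
Qed.

Section complex_coordinates.
Context (R : realType).

Lemma Im_continuous : continuous (@complex.Im R : R[i]^o -> R).
Proof.
move=> z; have -> : (@complex.Im R : R[i]^o -> R) = (fun w => complex.Re (- 'i%C * w)).
  by apply/funext => -[x y] /=; rewrite oppr0 mul0r sub0r mulN1r opprK.
apply: (@continuous_comp _ R[i]^o R (fun w : R[i]^o => - 'i%C * w : R[i]^o)).
  exact: (@mulrl_continuous R[i]^o).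
exact: Re_continuous.
Qed.

Lemma real_complex_continuous : continuous (fun x : R => (x%:C)%C : R[i]^o).
Proof.
move=> x; apply/(@cvgrPdist_lt _ R[i]^o _ _) => e /gtc0_Re[e0 ->].
near=> y; rewrite -rmorphB normc_def /= expr0n addr0 sqrtr_sqr ltcR.
by near: y; apply: (@cvgr_dist_lt _ R _ _ _ id).
Unshelve. all: by end_near. Qed.

End complex_coordinates.

Section gelfand_transform.
Context (R : realType) (A : comCStarAlgType R[i]).
Local Notation C := R[i].
Local Notation B := (calg A).
Local Notation S := (selfadj A).
Local Notation spec := (character A).
Implicit Types (a b : A) (x y : S) (chi xi : spec).

Definition gelfand (a : A) : cfun R spec := mkcfun (@ch_eval_continuous R A a).

Lemma gelfand_star_homomorphism : star_homomorphism gelfand.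
Proof.
split=> [k a b|a b|a]; apply: cfunP => chi.
- by rewrite -[LHS]/(chi (k *: a + b)) chD chZ.
- exact: chM.
- exact: ch_star.
Qed.

Lemma gelfand1 : gelfand cone = cone.
Proof. by apply: cfunP => chi; exact: ch1. Qed.

Lemma gelfandB a b : gelfand (a - b) = gelfand a - gelfand b.
Proof. by apply: cfunP => chi; rewrite -[LHS]/(chi (a - b)) chD chN. Qed.

Lemma gelfand_isometry a : `|gelfand a| = `|a|.
Proof.
apply/le_anti/andP; split; first by apply: cfun_norm_le => // chi; exact: ch_le.
have [->|/eqP a0] := eqVneq a 0; first by rewrite normr0.
by have [chi <-] := character_attains a0; exact: (cfun_norm_ub (gelfand a)).
Qed.

Lemma gelfand_inj : injective gelfand.
Proof.
move=> a b ab; apply/eqP; rewrite -subr_eq0 -normr_eq0 -gelfand_isometry gelfandB ab.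
by rewrite subrr normr0.
Qed.

(** The range of an isometry defined on a complete space is closed. *)
Lemma gelfand_closed (f : cfun R spec) :
  (forall e : R, 0 < e -> exists a, rnorm (f - gelfand a) <= e) ->
  exists a, gelfand a = f.
Proof.
move=> fA.
have half0 : 0 < 2^-1 :> R by lra.
have half1 : (2^-1 : R) < 1 by lra.
have /choice[u uf] (n : nat) : exists a, rnorm (f - gelfand a) <= 2^-1 ^+ n.
  by apply: fA; rewrite exprn_gt0.
have small (e : R) : 0 < e ->
    exists m, forall n, (m <= n)%N -> rnorm (f - gelfand (u n)) <= e.
  move=> e0; have [m me] := small_power (ltW half0) half1 e0; exists m => n mn.
  apply: le_trans (uf n) _; apply: le_trans me; apply: ler_wiXn2l => //; exact: ltW.
have isoB a b : rnorm (a - b) = rnorm (gelfand a - gelfand b).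
  by rewrite -gelfandB /rnorm gelfand_isometry.
have [e e0|l lP] := @rnorm_complete R A u.
  have e20 : 0 < e / 2 by lra.
  have [m me] := small _ e20; exists m => n mn; rewrite isoB.
  have -> : gelfand (u n) - gelfand (u m) = (f - gelfand (u m)) - (f - gelfand (u n)).
    by rewrite opprB [RHS]addrC addrA subrK.
  apply: le_trans (rnormD _ _) _; rewrite rnormN.
  by have := me _ mn; have := me _ (leqnn m); lra.
exists l; apply/eqP; rewrite -subr_eq0; apply/eqP/rnorm_eq0/le_anti; rewrite rnorm_ge0 andbT.
apply: ler_eps => e e0; rewrite add0r; have e20 : 0 < e / 2 by lra.
have [m me] := small _ e20; have [k ke] := lP _ e20.
have -> : gelfand l - f =
    (gelfand l - gelfand (u (maxn m k))) - (f - gelfand (u (maxn m k))).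
  by rewrite opprB addrA subrK.
apply: le_trans (rnormD _ _) _; rewrite rnormN -isoB.
by have := me _ (leq_maxl m k); have := ke _ (leq_maxr m k); lra.
Qed.

(** The Gelfand transform of a self-adjoint element, as a real function. *)
Definition hat x chi : R := complex.Re (chi (val x)).

Lemma hat_rchar chi : real_character (@sa_cst R A) (hat^~ chi).
Proof. exact: ch_real_character. Qed.

Lemma hatD x y chi : hat (x + y) chi = hat x chi + hat y chi.
Proof. exact: (rcharD (hat_rchar chi)). Qed.

Lemma hatM x y chi : hat (x * y) chi = hat x chi * hat y chi.
Proof. exact: (rcharM (hat_rchar chi)). Qed.

Lemma hat_cst r chi : hat (sa_cst A r) chi = r.
Proof. exact: (rchar_cst (hat_rchar chi)). Qed.

Lemma hatN x chi : hat (- x) chi = - hat x chi.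
Proof. exact: (rcharN (hat_rchar chi)). Qed.

Lemma hat_continuous x : continuous (hat x).
Proof.
move=> chi; apply: (@continuous_comp _ R[i]^o R (fun xi : spec => xi (val x))).
  exact: ch_eval_continuous.
exact: Re_continuous.
Qed.

Lemma ch_hat x chi : chi (val x) = ((hat x chi)%:C)%C.
Proof. exact: ch_sa_real. Qed.

Lemma ch_re_im a chi : chi a = (hat (sa_re a) chi +i* hat (sa_im a) chi)%C.
Proof.
rewrite {1}(sa_re_im (a : B)) chD -[_ * _]/(cmul (scalar A 'i : A) (val (sa_im a) : A)).
by rewrite chM ch_scalar !ch_hat [RHS]complexE.
Qed.

(** The root w >= 0 of x^2 + e^2 satisfies |x| <= w <= |x| + e on the spectrum,
    so |x| lies in the closed range of the Gelfand transform. The point [chi0]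
    witnesses that the algebra is nonzero. *)
Lemma hat_abs x (chi0 : spec) : exists y, forall chi, hat y chi = `|hat x chi|.
Proof.
have NS := sa_norm_segal (character_nontrivial chi0).
have fc : continuous (fun chi => (`|hat x chi|%:C)%C : R[i]^o).
  move=> chi; apply: (@continuous_comp _ R R[i]^o (fun xi => `|hat x xi|)).
    by apply: (@continuous_comp _ R R (hat x)); [exact: hat_continuous|exact: norm_continuous].
  exact: real_complex_continuous.
have [e e0|a aE] := @gelfand_closed (mkcfun fc).
  have e20 : 0 < e ^+ 2 by rewrite exprn_gt0.
  have [y yE y0] := sos_root NS (preord_sqr (@sum_of_squares_preordering _) x) e20.
  exists (val y); rewrite -rnorm_le; apply: cfun_norm_le; first by rewrite lecR ltW.
  move=> chi; rewrite -[X in `|X|]/((`|hat x chi|%:C)%C - chi (val y)) ch_hat -rmorphB.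
  have := y0 _ (hat_rchar chi).
  have : hat (x * x + sa_cst A (e ^+ 2)) chi = hat (y * y) chi by rewrite yE.
  rewrite hatD !hatM hat_cst => E w0.
  rewrite normc_def /= expr0n addr0 sqrtr_sqr lecR.
  have t2 : hat x chi * hat x chi = `|hat x chi| ^+ 2.
    by rewrite -expr2 -normrX ger0_norm ?sqr_ge0.
  rewrite t2 in E; have := normr_ge0 (hat x chi); move: E w0.
  move: (`|hat x chi|) (hat y chi) => t w E w0 t0.
  by rewrite ler_norml; apply/andP; split; nra.
exists (sa_re a) => chi.
have := ch_re_im a chi; rewrite -[LHS]/(gelfand a chi) aE.
by move=> [].
Qed.

Lemma hat_max x y (chi0 : spec) :
  exists z, forall chi, hat z chi = Num.max (hat x chi) (hat y chi).
Proof.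
have [z zE] := hat_abs (x - y) chi0; exists (sa_cst A 2^-1 * (x + y + z)) => chi.
by rewrite hatM hat_cst !hatD zE hatD hatN maxr_absE mulrC.
Qed.

Lemma hat_min x y (chi0 : spec) :
  exists z, forall chi, hat z chi = Num.min (hat x chi) (hat y chi).
Proof.
have [z zE] := hat_max (- x) (- y) chi0; exists (- z) => chi.
by rewrite hatN zE !hatN oppr_max !opprK.
Qed.

(** Characters that differ already differ on a self-adjoint element, and an
    affine function of it takes any two prescribed values. *)
Lemma hat_interpolate chi xi (s t : R) : (chi = xi -> s = t) ->
  exists x, hat x chi = s /\ hat x xi = t.
Proof.
move=> st; have [e|ne] := pselect (chi = xi); last first.
  have [a /eqP na] : exists a, chi a <> xi a.
    apply: contrapT => /forallNP H; apply: ne; apply: characterP => a.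
    exact: contrapT (H a).
  have [x xne] : exists x, hat x chi - hat x xi != 0.
    apply: contrapT => /forallNP H; move/eqP: na; apply.
    rewrite !ch_re_im; congr (_ +i* _)%C; apply/eqP; rewrite -subr_eq0;
      by apply: contrapT => /negP/H.
  exists (sa_cst A ((s - t) / (hat x chi - hat x xi)) *
    (x - sa_cst A (hat x xi)) + sa_cst A t).
  rewrite !(hatD, hatM, hatN, hat_cst) subrr mulr0 add0r; split=> //.
  by rewrite mulfVK// subrK.
by exists (sa_cst A s); rewrite -e hat_cst; split; [by []|exact: (st e)].
Qed.

(** For a fixed chi, interpolation at chi and xi gives an element above f - e
    near xi and equal to f at chi; maxima extend the first property to the whole
    spectrum. By continuity the result is below f + e near chi, and minima of
    such elements, as chi varies, are below f + e everywhere. *)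
Lemma stone_weierstrass (f : spec -> R) (e : R) : continuous f -> 0 < e ->
  exists x, forall chi, `|f chi - hat x chi| <= e.
Proof.
move=> fc e0; have [[chi0 _]|n0] := pselect (exists chi : spec, True); last first.
  by exists 0 => chi; case: n0; exists chi.
have below chi : exists x, hat x chi = f chi /\ forall xi, f xi - e < hat x xi.
  have [||||xi|x [xE xP]] := @compact_induction spec
      (fun U => exists x, hat x chi = f chi /\ forall xi, U xi -> f xi - e < hat x xi).
  - exact: compact_space.
  - by exists (sa_cst A (f chi)); split; [exact: hat_cst|].
  - move=> U V [x [xE xU]] [y [yE yV]]; have [z zE] := hat_max x y chi0.
    exists z; rewrite zE xE yE maxxx; split=> // xi [/xU|/yV] H;
      by rewrite zE lt_max H ?orbT.
  - by move=> U V UV [x [xE xV]]; exists x; split=> // xi /UV; exact: xV.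
  - have [x [xE1 xE2]] := @hat_interpolate chi xi (f chi) (f xi) (fun h => congr1 f h).
    exists [set zeta | f zeta - e < hat x zeta]; last by exists x; split.
    have : (fun zeta => f zeta - hat x zeta) @ xi --> f xi - hat x xi.
      exact: (cvgB (fc xi) (@hat_continuous x xi)).
    by move/cvgr_lt => /(_ e); rewrite xE2 subrr => /(_ e0); apply: filterS => zeta /=; lra.
  by exists x; split=> // xi; exact: xP.
have [||||xi|x [xE xP]] := @compact_induction spec
    (fun U => exists x, (forall xi, f xi - e < hat x xi) /\
       forall xi, U xi -> hat x xi < f xi + e).
- exact: compact_space.
- by have [x [_ xf]] := below chi0; exists x.
- move=> U V [x [xE xU]] [y [yE yV]]; have [z zE] := hat_min x y chi0.
  exists z; split=> [xi|xi [/xU|/yV] H];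
    by rewrite zE ?lt_min ?xE ?yE// gt_min H ?orbT.
- by move=> U V UV [x [xE xV]]; exists x; split=> // xi /UV; exact: xV.
- have [x [xE xf]] := below xi.
  exists [set zeta | hat x zeta < f zeta + e]; last by exists x; split.
  have : (fun zeta => hat x zeta - f zeta) @ xi --> hat x xi - f xi.
    exact: (cvgB (@hat_continuous x xi) (fc xi)).
  by move/cvgr_lt => /(_ e); rewrite xE subrr => /(_ e0); apply: filterS => zeta /=; lra.
exists x => chi; rewrite ler_norml; have := xE chi; have := xP chi I; lra.
Qed.

Lemma gelfand_surj (f : cfun R spec) : exists a, gelfand a = f.
Proof.
apply: gelfand_closed => e e0; have e20 : 0 < e / 2 by lra.
have [chi|x xf] := @stone_weierstrass (fun chi => complex.Re (f chi)) _ _ e20.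
  by apply: (@continuous_comp _ R[i]^o R f); [exact: cfun_continuous|exact: Re_continuous].
have [chi|y yf] := @stone_weierstrass (fun chi => complex.Im (f chi)) _ _ e20.
  by apply: (@continuous_comp _ R[i]^o R f); [exact: cfun_continuous|exact: Im_continuous].
exists ((val x : B) + scalar A 'i * (val y : B)).
rewrite -rnorm_le; apply: cfun_norm_le; first by rewrite lecR ltW.
move=> chi; rewrite -[X in `|X|]/(f chi - chi _).
rewrite chD -[_ * _]/(cmul (scalar A 'i : A) (val y : A)) chM ch_scalar !ch_hat.
have <- : (hat x chi +i* hat y chi)%C = (hat x chi)%:C%C + 'i * (hat y chi)%:C%C.
  by rewrite [LHS]complexE.
apply: le_trans (normc_le_ReIm _) _; rewrite lecR.
have := xf chi; have := yf chi.
by case: (f chi) => p q /=; lra.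
Qed.

End gelfand_transform.

(** * The characters of C(X) are the points of X *)

Section points_of_CX.
Context (R : realType) (X : compactHausdorffType).
Local Notation C := R[i].
Local Notation CX := (cfun R X).
Implicit Types (f g h : CX) (x y : X).

Section evaluation.
Context (x : X).
Definition ev_fun (f : CX) : C := f x.
Fact evD f g : ev_fun (f + g) = ev_fun f + ev_fun g. Proof. by []. Qed.
Fact evM f g : ev_fun (cmul f g) = ev_fun f * ev_fun g. Proof. by []. Qed.
Fact evZ k f : ev_fun (k *: f) = k * ev_fun f. Proof. by []. Qed.
Fact ev_star f : ev_fun (star f) = (ev_fun f)^*. Proof. by []. Qed.
Fact ev1 : ev_fun cone = 1. Proof. by []. Qed.
Definition ev : character CX := Character evD evM evZ ev_star ev1.
End evaluation.

Lemma ev_continuous : continuous (ev : X -> character CX).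
Proof. by move=> x; apply: spectrum_cvg => f; exact: cfun_continuous. Qed.

(** If chi is not an evaluation, each point x has a function g in the kernel of
    chi with g x <> 0, so that h = g^* g >= 0 is in the kernel and positive near
    x. Adding finitely many such h gives an element of the kernel that is at
    least some d > 0 everywhere. Then M - h has norm at most M - d, but chi maps
    it to M, which contradicts [ch_le]. *)
Lemma ev_surj (chi : character CX) : exists x, ev x = chi.
Proof.
apply: contrapT => /forallNP nev.
have [|||||h [d [d0 chih h0 hd]]] := @compact_induction X (fun U => exists h (d : R),
    [/\ 0 < d, chi h = 0, forall y, 0 <= h y & forall y, U y -> d%:C%C <= h y]).
- exact: compact_space.
- by exists 0, 1; split=> //; exact: ch0.
- move=> U V [h [d [d0 chih h0 hU]]] [g [c [c0 chig g0 gV]]].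
  exists (h + g), (Num.min d c); split.
  + by rewrite lt_min d0.
  + by rewrite chD chih chig addr0.
  + by move=> y; exact: addr_ge0 (h0 y) (g0 y).
  + move=> y [/hU|/gV] H.
      apply: le_trans (_ : d%:C%C <= _); first by rewrite lecR ge_min lexx.
      exact: ler_wpDr (g0 y) H.
    apply: le_trans (_ : c%:C%C <= _); first by rewrite lecR ge_min lexx orbT.
    exact: ler_wpDl (h0 y) H.
- by move=> U V UV [h [d [d0 chih h0 hV]]]; exists h, d; split=> // y /UV; exact: hV.
- move=> x.
  have [f fx] : exists f, chi f != f x.
    apply: contrapT => /forallNP H; apply: (nev x); apply: characterP => f.
    by apply/esym/eqP; apply: contrapT => /negP/H.
  pose g : CX := f - (chi f) *: (cone : CX); pose h : CX := cmul (star g) g.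
  have gE y : g y = f y - chi f by rewrite -[LHS]/(f y - chi f * 1) mulr1.
  have hE y : h y = `|g y| ^+ 2 by rewrite normCK mulrC.
  have hR y : h y = (complex.Re (h y))%:C%C.
    by rewrite RRe_real// hE rpredX// normr_real.
  have chig : chi g = 0 by rewrite chD chN chZ ch1 mulr1 subrr.
  have hx : 0 < complex.Re (h x).
    by rewrite -ltcR -hR hE exprn_gt0// normr_gt0 gE subr_eq0 eq_sym.
  exists [set y | complex.Re (h x) / 2 < complex.Re (h y)]; last first.
    exists h, (complex.Re (h x) / 2); split.
    + by rewrite divr_gt0.
    + by rewrite chM chig mulr0.
    + by move=> y; rewrite hE exprn_ge0.
    + by move=> y /ltW; rewrite (hR y) lecR.
  have : (fun y => complex.Re (h y)) @ x --> complex.Re (h x).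
    apply: (@continuous_comp _ R[i]^o R h); first exact: cfun_continuous.
    exact: Re_continuous.
  move/cvgr_gt => /(_ (complex.Re (h x) / 2)); apply; lra.
pose M := rnorm h + d; pose g : CX := M%:C%C *: (cone : CX) - h.
have chig : chi g = M%:C%C by rewrite chD chN chih subr0 chZ ch1 mulr1.
have gM : `|g| <= (rnorm h)%:C%C.
  apply: cfun_norm_le; first by rewrite lecR rnorm_ge0.
  move=> y; rewrite -[X in `|X|]/(M%:C%C * 1 - h y) mulr1.
  have hy : h y <= (rnorm h)%:C%C.
    rewrite -rnormE; apply: le_trans (cfun_norm_ub h y).
    by rewrite ger0_norm.
  have hy' : h y <= M%:C%C by apply: le_trans hy _; rewrite lecR lerDl ltW.
  rewrite ger0_norm ?subr_ge0// lerBlDr /M rmorphD lerD2l; exact: hd.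
have := le_trans (ch_le chi g) gM; rewrite chig normc_def /= expr0n addr0 sqrtr_sqr lecR.
by move=> /(le_trans (ler_norm M)); rewrite gerDl leNgt d0.
Qed.

Lemma urysohn_point (x : X) (U : set X) : nbhs x U ->
  exists f : CX, f x = 0 /\ forall y, ~ U y -> f y = 1.
Proof.
move=> xU.
have cr : completely_regular_space X.
  apply: (@normal_completely_regular R).
    exact: compact_normal (hausdorff (s := X)) (compact_space (s := X)).
  exact: hausdorff_accessible (hausdorff (s := X)).
have sep : uniform_separator [set x] (~` U°).
  apply: cr; first exact/open_closedC/open_interior.
  by move=> /= /(_ xU).
have [f [fc _ f0 f1]] := (@uniform_separatorP X R [set x] (~` U°)).1 sep.
have gc : continuous (fun y => (f y)%:C%C : R[i]^o).
  move=> y; apply: (@continuous_comp _ R R[i]^o f); first exact: fc.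
  exact: real_complex_continuous.
exists (mkcfun gc); split.
  by rewrite -[LHS]/((f x)%:C%C) (_ : f x = 0)//; apply: f0; exists x.
move=> y Uy; rewrite -[LHS]/((f y)%:C%C) (_ : f y = 1)//; apply: f1; exists y => //.
by move=> /interior_subset.
Qed.

Lemma ev_inj : injective ev.
Proof.
move=> x y xy; apply: (@hausdorff X) => U V xU yV.
have [f [fx fU]] := urysohn_point xU.
exists y; split; last exact: nbhs_singleton.
apply: contrapT => /fU fy.
have : ev x f = ev y f by rewrite xy.
by rewrite -[LHS]/(f x) -[RHS]/(f y) fx fy => /eqP; rewrite eq_sym oner_eq0.
Qed.

Definition point_of (chi : character CX) : X := sval (cid (ev_surj chi)).

Lemma ev_point chi : ev (point_of chi) = chi.
Proof. by rewrite /point_of; case: cid. Qed.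

Lemma point_ev x : point_of (ev x) = x.
Proof. by apply: ev_inj; rewrite ev_point. Qed.

(** Let f vanish at the point of chi and equal 1 off U. The characters xi with
    |chi f - xi f| < 1 form a neighbourhood of chi, and their points are in U. *)
Lemma point_of_continuous : continuous point_of.
Proof.
move=> chi U /urysohn_point[f [fx fU]].
have /(@cvgr_dist_lt _ R[i]^o) /(_ 1 ltr01) := @ch_eval_continuous R CX f chi.
apply: filterS => xi /=.
rewrite -{1}(ev_point chi) -{1}(ev_point xi) -[ev _ f]/(f _) fx -[ev _ f]/(f _).
move=> H; apply: contrapT => /fU fy; move: H.
by rewrite fy sub0r normrN normr1 ltxx.
Qed.

End points_of_CX.

(** * The duality *)

Section gelfand_duality.
Context (R : realType).
Local Notation C := R[i].
Local Notation cau := (CAU R[i]).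

Section pullback.
Context (X Y : compactHausdorffType) (p : continuousType Y X).

Fact pullback_continuous (f : cfun R X) : continuous (fun y => f (p y) : R[i]^o).
Proof.
move=> y; apply: (@continuous_comp _ _ R[i]^o p f); first exact: cts_fun.
exact: cfun_continuous.
Qed.

Definition pullback_fun (f : cfun R X) : cfun R Y := mkcfun (@pullback_continuous f).

Fact pullback_star_homomorphism : star_homomorphism pullback_fun.
Proof. by split=> [k f g|f g|f]; exact: cfunP. Qed.

Fact pullback1 : pullback_fun cone = cone.
Proof. exact: cfunP. Qed.

Definition pullback : unital_star_hom (cfun R X) (cfun R Y) :=
  UnitalStarHom pullback_star_homomorphism pullback1.

End pullback.

Fact functions_id (X : opposite HC) : pullback (idm X) = CAU_id (cfun R X).
Proof. by apply: unital_star_homP => f; exact: cfunP. Qed.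

Fact functions_comp (X Y Z : opposite HC) (g : Defs.hom Y Z) (f : Defs.hom X Y) :
  pullback (Defs.comp g f) = CAU_comp (pullback g) (pullback f).
Proof. by apply: unital_star_homP => h; exact: cfunP. Qed.

Definition functions : functor (opposite HC) cau :=
  @Functor (opposite HC) cau (fun X => cfun R X) (fun X Y f => pullback f)
    functions_id functions_comp.

Section precomposition.
Context (A B : comCStarAlgType R[i]) (u : unital_star_hom A B).

Lemma ushD a b : u (a + b) = u a + u b.
Proof. by have := starhom_linear (ush_star_hom u) 1 a b; rewrite !scale1r. Qed.

Lemma ush0 : u 0 = 0.
Proof. by apply: (@addrI _ (u 0)); rewrite -ushD !addr0. Qed.

Lemma ushZ k a : u (k *: a) = k *: u a.
Proof.
by have := starhom_linear (ush_star_hom u) k a 0; rewrite ush0 !addr0.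
Qed.

Section precompose.
Context (chi : character B).
Let v a := chi (u a).
Fact precompD a b : v (a + b) = v a + v b. Proof. by rewrite /v ushD chD. Qed.
Fact precompM a b : v (cmul a b) = v a * v b.
Proof. by rewrite /v (starhomM (ush_star_hom u)) chM. Qed.
Fact precompZ k a : v (k *: a) = k * v a. Proof. by rewrite /v ushZ chZ. Qed.
Fact precomp_star a : v (star a) = (v a)^*.
Proof. by rewrite /v (starhom_star (ush_star_hom u)) ch_star. Qed.
Fact precomp1 : v cone = 1. Proof. by rewrite /v ush1 ch1. Qed.
Definition precomp : character A :=
  Character precompD precompM precompZ precomp_star precomp1.
End precompose.

Fact precomp_continuous : continuous (precomp : character B -> character A).
Proof.
move=> chi; apply: (@spectrum_cvg R A _ _ (@fmap_filter _ _ precomp _ (nbhs_filter chi))) => a.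
exact: (@ch_eval_continuous R B (u a)).
Qed.

Definition spectrum_map : continuousType (character B) (character A) :=
  mkcts precomp_continuous.

End precomposition.

Fact spectrum_id (A : cau) : spectrum_map (idm A) = HC_id (character A).
Proof. by apply/continuousEP => chi; exact: characterP. Qed.

Fact spectrum_comp (A B D : cau) (g : Defs.hom B D) (f : Defs.hom A B) :
  spectrum_map (Defs.comp g f) = HC_comp (spectrum_map f) (spectrum_map g).
Proof. by apply/continuousEP => chi; exact: characterP. Qed.

Definition spectrum : functor cau (opposite HC) :=
  @Functor cau (opposite HC) (fun A => character A : compactHausdorffType)
    (fun A B f => spectrum_map f) spectrum_id spectrum_comp.

Section gelfand_iso.
Context (A : comCStarAlgType R[i]).

Definition gelfand_hom : unital_star_hom A (cfun R (character A)) :=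
  UnitalStarHom (gelfand_star_homomorphism A) (gelfand1 A).

Definition gelfand_inv (f : cfun R (character A)) : A := sval (cid (gelfand_surj f)).

Lemma gelfand_invK : cancel gelfand_inv (@gelfand R A).
Proof. by move=> f; rewrite /gelfand_inv; case: cid. Qed.

Lemma gelfandK : cancel (@gelfand R A) gelfand_inv.
Proof. by move=> a; apply: (@gelfand_inj R A); exact: gelfand_invK. Qed.

Fact gelfand_inv_star_homomorphism : star_homomorphism gelfand_inv.
Proof.
have [L M St] := gelfand_star_homomorphism A.
split=> [k f g|f g|f]; apply: (@gelfand_inj R A).
- by rewrite L !gelfand_invK.
- by rewrite M !gelfand_invK.
- by rewrite St !gelfand_invK.
Qed.

Fact gelfand_inv1 : gelfand_inv cone = cone.
Proof. by rewrite -gelfand1 gelfandK. Qed.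

Definition gelfand_inv_hom : unital_star_hom (cfun R (character A)) A :=
  UnitalStarHom gelfand_inv_star_homomorphism gelfand_inv1.

End gelfand_iso.

(** The inverse Gelfand transforms are natural because the Gelfand transforms
    are: both sides of the square agree after applying the transform. *)
Lemma functions_spectrum :
  naturally_isomorphic (functor_comp functions spectrum) (functor_id cau).
Proof.
exists (fun A => gelfand_inv_hom A), (fun A => gelfand_hom A); split.
- move=> A B u; apply: unital_star_homP => f /=.
  apply: (@gelfand_inj R B); rewrite gelfand_invK -{1}(gelfand_invK f).
  by apply: cfunP => chi.
- by move=> A; apply: unital_star_homP => f; exact: gelfand_invK.
- by move=> A; apply: unital_star_homP => a; exact: gelfandK.
Qed.

Lemma spectrum_functions : naturally_isomorphic
  (functor_comp spectrum functions) (functor_id (opposite HC)).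
Proof.
exists (fun X : compactHausdorffType =>
    mkcts (@ev_continuous R X) : continuousType X (character (cfun R X))),
  (fun X : compactHausdorffType =>
    mkcts (@point_of_continuous R X) : continuousType (character (cfun R X)) X).
split.
- by move=> X Y f; apply/continuousEP => y; exact: characterP.
- by move=> X; apply/continuousEP => chi; exact: ev_point.
- by move=> X; apply/continuousEP => x; exact: point_ev.
Qed.

End gelfand_duality.

Theorem theorem5p4 (R : realType) :
  equivalent_categories (opposite HC) (CAU R[i]) /\
  (forall A : comCStarAlgType R[i],
     exists X : compactHausdorffType,
       isometrically_star_isomorphic A (cfun R X)).
Proof.
split.
  exists (functions R), (spectrum R).
  by split; [exact: functions_spectrum|exact: spectrum_functions].
move=> A; exists (character A), (@gelfand R A); split.
- exact: gelfand_star_homomorphism.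
- by exists (@gelfand_inv R A); [exact: gelfandK|exact: gelfand_invK].
- exact: gelfand_isometry.
Qed.
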